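(* For every integer $n \geq 5$ there is an endpoint-homogeneous, $\frac{1}{n}$-homogeneous smooth fan.
   Context: A continuum is a nonempty compact connected metric space. A continuum is unicoherent if whenever it is the union of two subcontinua $A,B$, the set $A\cap B$ is connected; it is hereditarily unicoherent if every subcontinuum is unicoherent. A dendroid is an arcwise connected, hereditarily unicoherent continuum. In a dendroid $D$, any two distinct points $x,y$ are the endpoints of exactly one arc, denoted $[x,y]$ (and $[x,x]=\{x\}$). A point of $D$ is an endpoint of $D$ if it is an endpoint of every arc in $D$ that contains it; $E(D)$ denotes the set of endpoints. A ramification point of $D$ is the common point (top) of some simple triod contained in $D$ (a simple triod is three arcs glued together at one endpoint). A fan is a dendroid with exactly one ramification point $t$, called its top. A fan $F$ with top $t$ is smooth if for every convergent sequence $(x_n)$ in $F$, $\lim_{n\to\infty}[t,x_n]=[t,\lim_{n\to\infty} x_n]$ in the Hausdorff metric. A fan $F$ is endpoint-homogeneous if for any $e,e'\in E(F)$ there is a homeomorphism $h:F\to F$ with $h(e)=e'$. A space $Y$ is $\frac1n$-homogeneous if there is a partition of $Y$ into $n$ sets (but no fewer) such that any two points $x,y$ in the same piece admit a homeomorphism $h:Y\to Y$ with $h(x)=y$; equivalently, the natural action of the homeomorphism group of $Y$ on $Y$ has exactly $n$ orbits. *)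

(* Defs.v *)
From HB Require Import structures.
From mathcomp Require Import all_boot all_order all_algebra.
From mathcomp Require Import all_classical all_reals all_analysis.

Set Implicit Arguments.
Unset Strict Implicit.
Unset Printing Implicit Defensive.

Import Order.TTheory GRing.Theory Num.Theory.
Import numFieldNormedType.Exports.

Local Open Scope classical_set_scope.
Local Open Scope ring_scope.

(* The subspaces [A] and [B] are homeomorphic via the restriction of [f]; the
   values of [f] outside [A] are irrelevant. *)
Definition homeomorphism_on (T U : topologicalType) (A : set T) (B : set U)
    (f : T -> U) : Prop :=
  exists g : U -> T,
    [/\ set_fun A B f, set_fun B A g,
        (forall x, A x -> g (f x) = x) & (forall y, B y -> f (g y) = y)] /\
    {within A, continuous f} /\ {within B, continuous g}.

Definition homeomorphism (T U : topologicalType) (h : T -> U) : Prop :=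
  exists g : U -> T, [/\ cancel h g, cancel g h, continuous h & continuous g].

(* Subcontinua of [X] are subsets of [X]; [X] itself is a continuum when
   [continuum [set: X]]. *)
Definition continuum (T : topologicalType) (A : set T) : Prop :=
  [/\ A !=set0, compact A & connected A].

Definition unicoherent (T : topologicalType) (C : set T) : Prop :=
  forall A B : set T, continuum A -> continuum B -> A `|` B = C ->
    connected (A `&` B).

Definition hereditarily_unicoherent (T : topologicalType) (C : set T) : Prop :=
  forall A : set T, A `<=` C -> continuum A -> unicoherent A.

Section Dendroids.
Context {R : realType} {X : metricType R}.
Implicit Types (x y t e : X) (A B C : set X).

(* [A] is an arc with endpoints [x] and [y], which are then distinct. *)
Definition is_arc x y A : Prop :=
  exists f : R -> X, [/\ homeomorphism_on (`[0, 1] : set R) A f, f 0 = x & f 1 = y].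

(* [x, y] as a set; the choice is forced when the arc from [x] to [y] is
   unique, as it is in a dendroid. *)
Definition arc_segment x y : set X :=
  if x == y then [set x] else xget set0 [set A | is_arc x y A].

Definition endpoint e : Prop :=
  forall x y A, is_arc x y A -> A e -> e = x \/ e = y.

Definition simple_triod t (T : set X) : Prop :=
  exists (a b c : X) (A B C : set X),
    [/\ is_arc t a A, is_arc t b B & is_arc t c C] /\
    [/\ A `&` B = [set t], A `&` C = [set t], B `&` C = [set t] &
        T = A `|` B `|` C].

Definition ramification_point t : Prop := exists T : set X, simple_triod t T.

Definition metric_thickening (r : R) A : set X := \bigcup_(a in A) ball a r.

(* Meaningful on nonempty bounded sets only: [inf] is 0 on the empty set. *)
Definition hausdorff_dist A B : R :=
  inf [set r : R | [/\ 0 < r, A `<=` metric_thickening r B &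
                       B `<=` metric_thickening r A]].

End Dendroids.

Definition arcwise_connected {R : realType} (X : metricType R) : Prop :=
  forall x y : X, x <> y -> exists A : set X, is_arc x y A.

Definition dendroid {R : realType} (X : metricType R) : Prop :=
  [/\ continuum [set: X], arcwise_connected X &
      hereditarily_unicoherent [set: X]].

Definition fan_with_top {R : realType} (X : metricType R) (t : X) : Prop :=
  dendroid X /\ [set x : X | ramification_point x] = [set t].

Definition smooth_at {R : realType} (X : metricType R) (t : X) : Prop :=
  forall (u : nat -> X) (x : X), u @ \oo --> x ->
    hausdorff_dist (arc_segment t (u n)) (arc_segment t x)
      @[n --> \oo] --> (0 : R).

Definition smooth_fan {R : realType} (X : metricType R) : Prop :=
  exists t : X, fan_with_top t /\ smooth_at t.

Definition endpoint_homogeneous {R : realType} (X : metricType R) : Prop :=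
  forall e e' : X, endpoint e -> endpoint e' ->
    exists h : X -> X, homeomorphism h /\ h e = e'.

(* [partition] requires the [n] pieces to be nonempty. *)
Definition homogeneous_partition (T : topologicalType) (n : nat) : Prop :=
  exists P : 'I_n -> set T,
    partition [set: 'I_n] P [set: T] /\
    forall (i : 'I_n) (x y : T), P i x -> P i y ->
      exists h : T -> T, homeomorphism h /\ h x = y.

(* 1/n-homogeneity *)
Definition fractionally_homogeneous (T : topologicalType) (n : nat) : Prop :=
  homogeneous_partition T n /\
  forall m : nat, (m < n)%N -> ~ homogeneous_partition T m.

(* Main.v *)
(* The legs of the fan are indexed by the finite words over a countable alphabet.
   Leg [c] is approached by shorter legs [i :: c], whose tips accumulate on leg
   [c] exactly at the points of a prescribed set S of relative heights, while
   everything attached to [i :: c] shrinks to the top as [i] varies. Leg [c] and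
   leg [i :: c] can be exchanged together with the legs attached to them, so all
   legs, hence all endpoints, are equivalent, whatever S is. A homeomorphism of
   the leg [0, 1] that preserves S extends to the fan by permuting the letters;
   conversely S is the set of inner points that are limits of endpoints, hence
   is preserved by every homeomorphism of the fan. So the orbits in the interior
   of a leg are those of the increasing homeomorphisms of [0, 1] preserving S. If
   S has [l >= 1] points there are [2 l + 1] of them, which with the top and
   the endpoints gives [2 l + 3]. Adding to S a chain of order type Z that fills
   the gap between the top and the first point of S splits this gap into two
   orbits, and gives [2 l + 4]. *)
Require Import Defs.
From HB Require Import structures.
From mathcomp Require Import all_boot all_order all_algebra.
From mathcomp Require Import all_classical all_reals all_analysis.
From mathcomp Require Import ring lra zify.

Set Implicit Arguments.
Unset Strict Implicit.
Unset Printing Implicit Defensive.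

Import Order.TTheory GRing.Theory Num.Theory.
Import numFieldNormedType.Exports.

Local Open Scope classical_set_scope.
Local Open Scope ring_scope.

(** What is attached to leg [c] stays below [ratio c * cut], and [scale_cut] keeps this strictly
    below the tip of [c]. So every leg has an upper part which, its tip apart, contains no limit of
    endpoints and can be stretched at will. This makes legs of unrelated lengths exchangeable: the
    map is linear below [ratio c * cut], where it has to fit the attached legs, and corrects the
    length above. Exchanging two branches does not harm continuity away from the top, because the
    words ending in a given word form a clopen set of legs; at the top it is enough that lengths are
    distorted by a bounded factor. To separate orbits, everything is phrased topologically. Closed
    connected sets issuing from a point tell the top (three of them) and the endpoints (not even
    two) from the other points, and those through the top recover the order on a leg. Two heights in
    one orbit then agree on being in S and on the number of elements of S at or above them. In the
    chain this number is infinite, and the first invariant alone separates its two orbits. The bound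
    5 comes from [l >= 1]: [cut] is the last point of S and must be positive. *)

(* A leg is coded by a word; words grow to the left, and the legs [i :: c]
   converge to an initial part of leg [c], of relative height [tip i], as
   [scale i] tends to 0. What is attached to [i :: c] is scaled down by
   [scale i], so that it shrinks to the top. *)
Record fan_spec (R : realType) := FanSpec {
  letter : choiceType;
  cut : R;
  tip : letter -> R;
  scale : letter -> R;
  cut_gt0 : 0 < cut;
  cut_lt1 : cut < 1;
  tip_gt0 : forall i, 0 < tip i;
  tip_le : forall i, tip i <= cut;
  scale_gt0 : forall i, 0 < scale i;
  scale_le : forall i, scale i <= 2^-1;
  scale_cut : forall i, scale i * cut < tip i;
  scale_fin : forall e, 0 < e -> exists L : seq letter,
    forall i, e <= scale i -> i \in L
}.

(** * Words, lengths of legs, and the metric of the fan *)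

Section FanSpace.
Context {R : realType} (P : fan_spec R).
Notation word := (seq (letter P)).
Implicit Types (s c u : word) (i j : letter P).

(** The unit of length for what is attached to leg [s]. The length [len s] of the leg itself is not
    proportional to it, since [tip] and [scale] are unrelated. *)
Fixpoint ratio s : R := if s is i :: c then scale i * ratio c else 1.

Definition len s : R := if s is i :: c then tip i * ratio c else 1.

(** The cap of the coordinate at [s]. The root gets 1, the largest height, so that its coordinate is
    the height itself. *)
Definition weight s : R := if s is i :: _ then scale i else 1.

Lemma ratio_gt0 s : 0 < ratio s.
Proof. by elim: s => //= i c ?; rewrite mulr_gt0 ?scale_gt0. Qed.

Lemma ratio_le1 s : ratio s <= 1.
Proof.
elim: s => //= i c; have := scale_le i; have := scale_gt0 i; have := ratio_gt0 c.
nra.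
Qed.

Lemma ratio_le s : ratio s <= weight s.
Proof.
case: s => //= i c; have := scale_gt0 i; have := ratio_gt0 c; have := ratio_le1 c.
nra.
Qed.

Lemma ratio_exp s : ratio s <= 2^-1 ^+ size s.
Proof.
elim: s => [|i c IH]; first by rewrite expr0.
rewrite [size _]/= exprS; apply: ler_pM => //; first exact/ltW/scale_gt0.
  exact/ltW/ratio_gt0.
exact: scale_le.
Qed.

Lemma weight_gt0 s : 0 < weight s.
Proof. by case: s => //= i c; exact: scale_gt0. Qed.

Lemma len_gt0 s : 0 < len s.
Proof. by case: s => //= i c; rewrite mulr_gt0 ?tip_gt0 ?ratio_gt0. Qed.

Lemma ratio_cut_len s : ratio s * cut P < len s.
Proof.
case: s => [|i c] /=; first by rewrite mul1r cut_lt1.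
have := scale_cut i; have := ratio_gt0 c; nra.
Qed.

Lemma len_cons i c : len (i :: c) <= ratio c * cut P.
Proof. by rewrite /= mulrC ler_wpM2l ?tip_le// ltW ?ratio_gt0. Qed.

Lemma ratio_cut_gt0 s : 0 < ratio s * cut P.
Proof. by rewrite mulr_gt0 ?ratio_gt0 ?cut_gt0. Qed.

Lemma len_consW i c : len (i :: c) <= len c.
Proof. exact: le_trans (len_cons i c) (ltW (ratio_cut_len c)). Qed.

Lemma len_le1 s : len s <= 1.
Proof. by elim: s => //= i c IH; exact: le_trans (len_consW i c) IH. Qed.

Lemma suffix_consE u i c : suffix u (i :: c) = (u == i :: c) || suffix u c.
Proof.
apply/suffixP/orP => [[[|x t] /= e]|].
- by left; rewrite e.
- by right; case: e => _ ->; exact: suffix_suffix.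
- by case=> [/eqP ->|/suffixP[t ->]]; [exists [::] | exists (i :: t)].
Qed.

Lemma cons_suffix_neq i c : suffix (i :: c) c = false.
Proof. by apply/negP => /size_suffix /=; rewrite ltnn. Qed.

Lemma suffix_anti s c : suffix s c -> suffix c s -> s = c.
Proof.
move=> /suffixP[t ->]; case: t => //= i t /size_suffix /=.
by rewrite size_cat; lia.
Qed.

Lemma suffix_child s c : suffix c s -> s <> c -> exists i, suffix (i :: c) s.
Proof.
move=> /suffixP[t ->]; case/lastP: t => [//|t i] _.
by exists i; rewrite cat_rcons; exact: suffix_suffix.
Qed.

Lemma len_suffix c s : suffix c s -> len s <= len c.
Proof.
move=> /suffixP[t ->]; elim: t => //= i t; apply: le_trans.
exact: len_consW.
Qed.

(** A proper descendant of [i :: c] is no longer than one of its children, hence than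
    [ratio (i :: c) * cut]. So above height [scale i] the branch at [i :: c] is a single leg. *)
Lemma len_deep i c s : suffix (i :: c) s -> s <> i :: c -> len s <= scale i.
Proof.
move=> ics /(suffix_child ics)[j /len_suffix/le_trans]; apply.
apply: le_trans (len_cons _ _) _; have := ratio_le (i :: c).
by have := ratio_cut_gt0 (i :: c); have := cut_lt1 P; have := cut_gt0 P;
  have := ratio_gt0 (i :: c); rewrite /=; nra.
Qed.

(* A point is a leg and a height above the top; the top itself is [([::], 0)]. *)
Definition fan_pred (p : word * R) : bool :=
  (0 < p.2 <= len p.1) || (p == ([::], 0)).

Record fan := Fan { fan_val : word * R; fanP : fan_pred fan_val }.

HB.instance Definition _ := [isSub for fan_val].
HB.instance Definition _ := [Choice of fan by <:].

Implicit Types (p x y : fan).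

Definition arm p := (fan_val p).1.
Definition height p := (fan_val p).2.

Fact top_subproof : fan_pred ([::], 0).
Proof. by rewrite /fan_pred eqxx orbT. Qed.

Definition top : fan := Fan top_subproof.

(** Total in [r]: heights beyond the tip are clamped and nonpositive ones give the top, which makes
    [pt c] continuous on the whole line. *)
Definition pt c (r : R) : fan := insubd top (c, Num.min r (len c)).

Lemma fan_eq x y : arm x = arm y -> height x = height y -> x = y.
Proof.
by move=> ea eh; apply: val_inj; rewrite /= [LHS]surjective_pairing
  [RHS]surjective_pairing -/(arm x) -/(height x) ea eh.
Qed.

Lemma height_ge0 p : 0 <= height p.
Proof.
by have /orP[/andP[/ltW]//|/eqP e] := fanP p; rewrite /height e.
Qed.

Lemma height_le p : height p <= len (arm p).
Proof.
have /orP[/andP[_]//|/eqP e] := fanP p.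
by rewrite /height /arm e; exact/ltW/len_gt0.
Qed.

Lemma height_le1 p : height p <= 1.
Proof. exact: le_trans (height_le p) (len_le1 _). Qed.

Lemma height_eq0 p : height p = 0 -> p = top.
Proof.
rewrite /height => h; apply: val_inj => /=.
by have := fanP p; rewrite /fan_pred h ltxx => /eqP.
Qed.

Lemma height_top : height top = 0. Proof. by []. Qed.

Lemma height_gt0 p : p <> top <-> 0 < height p.
Proof.
split=> [|h e]; last by move: h; rewrite e height_top ltxx.
by move=> pt0; rewrite lt_neqAle height_ge0 andbT; apply/eqP => /esym/height_eq0.
Qed.

Lemma pt_le0 c r : r <= 0 -> pt c r = top.
Proof.
move=> r0; apply: val_inj; rewrite val_insubd /fan_pred /=.
case: ifP => // /orP[/andP[]|/eqP //].
by rewrite lt_min => /andP[]; rewrite ltNge r0.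
Qed.

Lemma val_pt c r : 0 < r -> val (pt c r) = (c, Num.min r (len c)).
Proof.
by move=> r0; rewrite val_insubd /fan_pred /= lt_min r0 len_gt0 ge_min lexx orbT.
Qed.

Lemma arm_pt c r : 0 < r -> arm (pt c r) = c.
Proof. by move=> r0; rewrite /arm val_pt. Qed.

Lemma height_pt c r : 0 <= r <= len c -> height (pt c r) = r.
Proof.
move=> /andP[]; rewrite le_eqVlt => /orP[/eqP <- _|r0 rc]; first by rewrite pt_le0.
by rewrite /height val_pt //=; apply/min_idPl.
Qed.

Lemma ptK p : pt (arm p) (height p) = p.
Proof.
have [e|/height_gt0 p0] := pselect (p = top); first by rewrite e pt_le0.
by apply: fan_eq; [rewrite arm_pt | rewrite height_pt // height_ge0 height_le].
Qed.

(* The coordinates embed the fan in the bounded functions on words: the legs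
   [c] and [i :: c] differ only at [i :: c], by at most [scale i]. *)
Definition coord p u : R := if suffix u (arm p) then Num.min (height p) (weight u) else 0.

Lemma coord_root p : coord p [::] = height p.
Proof. by rewrite /coord suffix0s; apply/min_idPl; exact: height_le1. Qed.

Lemma coord_ge0 p u : 0 <= coord p u.
Proof. by rewrite /coord; case: ifP => //; rewrite le_min height_ge0 ltW ?weight_gt0. Qed.

Lemma coord_le p u : coord p u <= height p.
Proof. by rewrite /coord; case: ifP => [_|_]; rewrite ?ge_min ?lexx// height_ge0. Qed.

Lemma coord_top u : coord top u = 0.
Proof. by apply/eqP; rewrite eq_le coord_ge0 -height_top coord_le. Qed.

Lemma coord_gt0 p u : 0 < height p -> (0 < coord p u) = suffix u (arm p).
Proof. by move=> h; rewrite /coord; case: ifP; rewrite ?ltxx// lt_min h weight_gt0. Qed.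

Definition dist x y : R := sup [set `|coord x u - coord y u| | u in [set: word]].

Lemma dist_has_ubound x y :
  has_ubound [set `|coord x u - coord y u| | u in [set: word]].
Proof.
exists 1 => _ [u _ <-]; rewrite ler_norml; apply/andP.
have := coord_ge0 x u; have := coord_ge0 y u.
have := le_trans (coord_le x u) (height_le1 x).
have := le_trans (coord_le y u) (height_le1 y); lra.
Qed.

Lemma dist_coord u x y : `|coord x u - coord y u| <= dist x y.
Proof. by apply: ub_le_sup; [exact: dist_has_ubound | exists u]. Qed.

Lemma dist_le x y M : (forall u, `|coord x u - coord y u| <= M) -> dist x y <= M.
Proof.
move=> h; apply: ge_sup; last by move=> _ [u _ <-].
by exists `|coord x [::] - coord y [::]|; exists [::].
Qed.

Lemma dist_height x y : `|height x - height y| <= dist x y.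
Proof. by rewrite -!coord_root; exact: dist_coord. Qed.

Lemma distxx x : dist x x = 0.
Proof.
apply/eqP; rewrite eq_le; apply/andP; split.
  by apply: dist_le => u; rewrite subrr normr0.
by have := dist_height x x; rewrite subrr normr0.
Qed.

Lemma dist_sym x y : dist x y = dist y x.
Proof. by congr sup; apply: eq_imagel => u _; rewrite distrC. Qed.

Lemma dist_triangle y x z : dist x z <= dist x y + dist y z.
Proof.
apply: dist_le => u; apply: le_trans (ler_distD (coord y u) _ _) _.
by apply: lerD; exact: dist_coord.
Qed.

(** The coordinate at the empty word is the height. Off the top, the words with a positive
    coordinate are the suffixes of the leg, and these determine it. *)
Lemma dist_eq0 x y : dist x y = 0 -> x = y.
Proof.
move=> d0; have e u : coord x u = coord y u.
  by apply/eqP; rewrite -subr_eq0 -normr_le0 -d0; exact: dist_coord.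
have eh : height x = height y by rewrite -!coord_root e.
have [x0|/height_gt0 x0] := pselect (x = top).
  by rewrite x0 in eh *; rewrite [RHS]height_eq0 // -eh.
have y0 : 0 < height y by rewrite -eh.
apply: fan_eq => //; apply: suffix_anti.
  by rewrite -coord_gt0 // -e coord_gt0 // suffix_refl.
by rewrite -coord_gt0 // e coord_gt0 // suffix_refl.
Qed.

HB.instance Definition _ := isMetric.Build R fan distxx dist_eq0 dist_sym dist_triangle.

Lemma fan_ballE p e : ball p e = [set y | dist p y < e].
Proof. by rewrite ballEmdist. Qed.

End FanSpace.

Arguments ratio {R P}.
Arguments len {R P}.
Arguments fan {R} P.
Arguments top {R P}.
Arguments pt {R P}.

Lemma ler_norm_min (R : realDomainType) (a b w : R) :
  `|Num.min a w - Num.min b w| <= `|a - b|.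
Proof.
have := ler_norm (a - b); have := ler_norm (b - a).
by rewrite distrC ler_norml; case: (leP a w); case: (leP b w); lra.
Qed.

(** * Neighbourhoods *)

Section FanTopology.
Context {R : realType} (P : fan_spec R).
Notation word := (seq (letter P)).
Implicit Types (s c u : word) (i j : letter P) (p x y : fan P) (r e : R).

Lemma dist_top p : dist top p = height p.
Proof.
apply/eqP; rewrite eq_le; apply/andP; split.
  by apply: dist_le => u; rewrite coord_top sub0r normrN ger0_norm ?coord_ge0 ?coord_le.
have := dist_height top p.
by rewrite height_top sub0r normrN ger0_norm ?height_ge0.
Qed.

Lemma nbhs_topP (U : set (fan P)) :
  nbhs top U <-> exists2 e, 0 < e & forall p, height p < e -> U p.
Proof.
split=> [/nbhs_ballP[e /= e0 h]|[e e0 h]].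
  by exists e => // p pe; apply: h; rewrite fan_ballE /= dist_top.
by apply/nbhs_ballP; exists e => //= p; rewrite fan_ballE /= dist_top; exact: h.
Qed.

(** A neighbourhood base at [pt c r] when [r > 0]. Descendants of [c] by more than one letter do not
    occur: below a child of small scale they are too short to reach height [r], by [len_deep]. *)
Definition close c (r e : R) p :=
  `|height p - r| < e /\ (arm p = c \/ exists2 i, scale i < e & arm p = i :: c).

Lemma closeW c r e e' p : e <= e' -> close c r e p -> close c r e' p.
Proof.
move=> ee [h1 h2]; split; first exact: lt_le_trans ee.
by case: h2 => [|[i ie ->]]; [left | right; exists i => //; exact: lt_le_trans ee].
Qed.

Lemma close_dist c r e p : 0 < r <= len c -> e <= r -> close c r e p ->
  dist (pt c r) p < e.
Proof.
move=> /andP[r0 rc] er [he ha].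
have hp : 0 < height p by move: he; rewrite ltr_norml; lra.
have hx : height (pt c r) = r by rewrite height_pt // ltW.
have ax : arm (pt c r) = c by rewrite arm_pt.
case: ha => [ap|[i ie ap]].
  apply: le_lt_trans he; apply: dist_le => u.
  rewrite /coord ax ap hx; case: ifP => _; last by rewrite subrr normr0.
  by rewrite (distrC _ r); exact: ler_norm_min.
apply: (@le_lt_trans _ _ (Num.max `|height p - r| (scale i))); last by rewrite gt_max he.
apply: dist_le => u; rewrite /coord ax ap hx suffix_consE le_max.
case: eqVneq => [->|_] /=.
  rewrite cons_suffix_neq sub0r normrN ger0_norm ?ge_min ?lexx ?orbT //.
  by rewrite le_min !ltW ?scale_gt0.
case: ifP => _; last by rewrite subrr normr0 normr_ge0.
by rewrite (distrC _ r) ler_norm_min.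
Qed.

Lemma dist_close c r e : 0 < r <= len c -> 0 < e ->
  exists2 d, 0 < d & forall p, dist (pt c r) p < d -> close c r e p.
Proof.
move=> /andP[r0 rc] e0; have w0 := weight_gt0 c.
have hx : height (pt c r) = r by rewrite height_pt // ltW.
have ax : arm (pt c r) = c by rewrite arm_pt.
(* [weight c / 2] keeps the coordinate at [c] positive, so the leg of [p] extends [c]; [r / 2] keeps
   the height above the scale of the next letter, so it extends [c] by one letter at most. *)
exists (Num.min e (Num.min (r / 2) (weight c / 2))).
  by rewrite !lt_min e0 /=; apply/andP; split; lra.
move=> p; rewrite !lt_min => /andP[de /andP[dr dw]].
have h1 := dist_height (pt c r) p; have h2 := dist_coord c (pt c r) p.
have h3 : coord (pt c r) c = Num.min r (weight c) by rewrite /coord ax hx suffix_refl.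
have hr : r / 2 < height p by move: h1; rewrite hx ler_norml; lra.
have hp : 0 < height p by lra.
have cp : suffix c (arm p).
  rewrite -coord_gt0 //; move: h2; rewrite h3 ler_norml.
  by case: (leP r (weight c)) => ? /andP[? ?]; lra.
split; first by rewrite distrC -hx; exact: le_lt_trans de.
have [ac|/(suffix_child cp)[i ip]] := pselect (arm p = c); [by left | right].
have h4 := dist_coord (i :: c) (pt c r) p.
move: h4; rewrite {1}/coord ax cons_suffix_neq sub0r normrN ger0_norm ?coord_ge0 //.
rewrite /coord ip ge_min /= => /orP[h4|h4]; first by lra.
exists i; first by lra.
have [//|/(len_deep ip)] := pselect (arm p = i :: c).
by have := height_le p => h5 h6; exfalso; lra.
Qed.

Lemma nbhs_ptP c r (U : set (fan P)) : 0 < r <= len c ->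
  nbhs (pt c r) U <-> exists2 e, 0 < e & forall p, close c r e p -> U p.
Proof.
move=> rc; split=> [/nbhs_ballP[e /= e0 h]|[e e0 h]].
  have /andP[r0 _] := rc.
  exists (Num.min e r); first by rewrite lt_min e0.
  move=> p /(close_dist rc) pe; apply: h; rewrite fan_ballE /=.
  by apply: lt_le_trans (pe _) _; rewrite ge_min lexx ?orbT.
have [d d0 dh] := dist_close rc e0.
by apply/nbhs_ballP; exists d => //= p; rewrite fan_ballE => /dh/h.
Qed.

Lemma fan_ind (Q : fan P -> Prop) :
  Q top -> (forall c r, 0 < r <= len c -> Q (pt c r)) -> forall p, Q p.
Proof.
move=> Qt Qp p; have [->//|/height_gt0 h] := pselect (p = top).
by rewrite -(ptK p); apply: Qp; rewrite h height_le.
Qed.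

Lemma height_continuous : continuous (@height R P).
Proof.
move=> p; apply/(@cvgrPdist_lt _ _ _ _ (nbhs_filter p)) => e e0; apply/nbhs_ballP; exists e => //= y.
by rewrite fan_ballE => /(le_lt_trans (dist_height _ _)).
Qed.

Lemma dist_pt c (r r' : R) : dist (pt c r) (pt c r') <= `|r - r'|.
Proof.
apply: dist_le => u.
have co a : coord (pt c a) u = if suffix u c then
    Num.min (Num.max 0 (Num.min a (len c))) (weight u) else 0.
  have w0 := weight_gt0 u; have l0 := len_gt0 c.
  have [a0|a0] := leP a 0.
    rewrite pt_le0 // coord_top (_ : Num.max _ _ = 0).
      by rewrite (min_idPl _) ?if_same// ltW.
    by apply/max_idPl; rewrite ge_min a0.
  rewrite /coord arm_pt //; case: ifP => // _; congr Num.min.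
  rewrite (max_idPr _) ?le_min ?(ltW a0) ?(ltW l0) //.
  by rewrite /height (val_pt _ a0).
rewrite !co; case: ifP => _; last by rewrite subrr normr0.
apply: le_trans (ler_norm_min _ _ _) _.
rewrite !(maxC 0); apply: le_trans (_ : _ <= `|Num.min r (len c) - Num.min r' (len c)|) _.
  set a := Num.min r _; set b := Num.min r' _.
  have := ler_norm (a - b); have := ler_norm (b - a).
  by rewrite distrC ler_norml; case: (leP a 0); case: (leP b 0); lra.
exact: ler_norm_min.
Qed.

Lemma pt_continuous c : continuous (@pt R P c).
Proof.
move=> r; apply/cvg_ballP => e e0; apply/nbhs_ballP; exists e => //= r' rr'.
by rewrite fan_ballE /=; exact: le_lt_trans (dist_pt _ _ _) rr'.
Qed.

(* A set of words is a branch when it is clopen in the base of the fan, where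
   the children [i :: c] of [c] tend to [c] as [scale i] tends to [0]. *)
Definition branch (M : set word) := forall c, exists2 e, 0 < e &
  forall i, scale i < e -> M (i :: c) <-> M c.

(** Legs outside [M] are collapsed to the height of the top. Being real-valued, this lets the
    intermediate value theorem take the place of separations. *)
Definition branch_height (M : set word) p : R :=
  if `[< M (arm p) >] then height p else 0.

Lemma branch_height_continuous M : branch M -> continuous (branch_height M).
Proof.
move=> bM; apply: fan_ind => [|c r rc]; apply/(@cvgrPdist_lt _ _ _ _ (nbhs_filter _)) => e e0.
  apply/nbhs_topP; exists e => // p pe.
  have -> : branch_height M top = 0 by rewrite /branch_height; case: ifP.
  rewrite sub0r normrN /branch_height; case: ifP => _.
    by rewrite ger0_norm // height_ge0.
  by rewrite normr0.
have [d d0 dM] := bM c; apply/(nbhs_ptP _ rc); exists (Num.min e d).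
  by rewrite lt_min e0.
have /andP[r0 _] := rc.
have hx : height (pt c r) = r by rewrite height_pt //; case/andP: rc => /ltW ->.
move=> p [hp ap]; move: hp; rewrite lt_min => /andP[hp _].
have Mp : M (arm p) <-> M c.
  by case: ap => [-> //|[i]]; rewrite lt_min => /andP[_ /dM h ->].
rewrite /branch_height arm_pt // hx (asbool_equiv_eq Mp); case: ifP => _.
  by rewrite distrC.
by rewrite subrr normr0.
Qed.

Lemma branchC M : branch M -> branch (~` M).
Proof.
by move=> bM c; have [e e0 h] := bM c; exists e => // i /h [h1 h2]; split=> nM /[dup] ? => [/h2|/h1].
Qed.

Lemma branch_suffix c : branch [set s | suffix c s].
Proof.
move=> s; exists (weight c); first exact: weight_gt0.
move=> i ic; rewrite /= suffix_consE; case: eqVneq => // e.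
by move: ic; rewrite e /= ltxx.
Qed.

(** A clopen set of legs around [c]. It contains whole branches, but at heights at least [e] only
    [c] and some of its children are left, by [len_deep]. *)
Definition stem c (e : R) : set word :=
  [set s | s = c \/ exists2 i, scale i < e & suffix (i :: c) s].

Lemma branch_stem c e : 0 < e -> branch (stem c e).
Proof.
move=> e0 s; exists (Num.min e (weight c)); first by rewrite lt_min weight_gt0 e0.
move=> i; rewrite lt_min => /andP[ie ic]; split=> [[h|[j je]]|[->|[j je js]]].
- by move: ic; rewrite -h /= ltxx.
- by rewrite suffix_consE => /orP[/eqP[_ ->]|js]; [left | right; exists j].
- by right; exists i => //; exact: suffix_refl.
- by right; exists j => //; rewrite suffix_consE js orbT.
Qed.

Lemma stemW c e p : stem c e (arm p) -> e <= height p ->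
  arm p = c \/ exists2 i, scale i < e & arm p = i :: c.
Proof.
case=> [|[i ie ip]]; [by left | move=> eh; right; exists i => //].
have [//|/(len_deep ip)] := pselect (arm p = i :: c).
by have := height_le p => h5 h6; exfalso; lra.
Qed.

End FanTopology.

Arguments branch_height {R P}.

(** * Compactness and connected subsets *)

Lemma half_expn_small (R : realType) (e : R) : 0 < e -> exists n, 2^-1 ^+ n < e.
Proof.
move=> e0; have [N _ /(_ N (leqnn N)) /= h] := near_infty_natSinv_expn_lt (PosNum e0).
by exists N; rewrite exprVn -div1r.
Qed.

Section FanContinuum.
Context {R : realType} (P : fan_spec R).
Notation word := (seq (letter P)).
Implicit Types (s c u : word) (i j : letter P) (p x y : fan P) (r e : R) (A B : set (fan P)).

Lemma fan_hausdorff : hausdorff_space (fan P).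
Proof. exact: metric_hausdorff. Qed.

(** The heights converge along an ultrafilter to some [r]. If [r > 0], there is a word [c] such that
    almost all legs end in [c] but in no [i :: c], because legs of long words are short. The
    finitely many letters of scale at least [e] can then be discarded, which leaves convergence to
    [pt c r]. *)
Lemma fan_compact : compact [set: fan P].
Proof.
rewrite compact_ultra => F FU _.
have [r [/= /andP[r0 r1] hr]] : (`[0, 1] `&` cluster (@height R P @ F)) !=set0.
  apply: segment_compact; have : F (@height R P @^-1` `[0, 1]) by
    apply: filterS filterT => p _; rewrite /= in_itv /= height_ge0 height_le1.
  by [].
rewrite !bnd_simp in r0 r1.
have nr e : 0 < e -> F [set p | `|height p - r| < e].
  move=> e0; have [//|h] := in_ultra_setVsetC [set p | `|height p - r| < e] FU.
  have FA : (@height R P @ F) (@height R P @` ~` [set p | `|height p - r| < e]).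
    by apply: (@filterS _ F _ _ _ _ h) => p np; exists p.
  have [_ [[p /= np <-]]] := hr _ _ FA (nbhsx_ballx _ _ e0).
  by rewrite /ball /= distrC.
move: r0; rewrite le_eqVlt => /orP[/eqP r0|r0].
  exists top; split=> // U /nbhs_topP[e e0 h]; apply: filterS (nr e e0) => p /=.
  by rewrite -r0 subr0 ger0_norm ?height_ge0 //; exact: h.
have [c [Fc nF]] : exists c, F [set p | suffix c (arm p)] /\
    forall i, ~ F [set p | suffix (i :: c) (arm p)].
  apply: contrapT => nc; have /half_expn_small[n nh] : 0 < r / 2 by lra.
  have [c [sc]] : exists c, size c = n.+1 /\ F [set p | suffix c (arm p)].
    elim: (n.+1) => [|m [c [sc Fc]]].
      by exists [::]; split=> //; apply: filterS filterT => p _; exact: suffix0s.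
    apply: contrapT => nm; apply: nc; exists c; split=> // i Fi; apply: nm.
    by exists (i :: c); rewrite /= sc.
  have r2 : 0 < r / 2 by lra.
  move=> /(filterI (nr _ r2)) /filter_ex[p [/= hp /len_suffix lp]].
  case: c sc lp => // i c [sc] lp; have := len_cons i c; have := ratio_exp c.
  have := height_le p; have := cut_lt1 P; have := cut_gt0 P; have := ratio_gt0 c.
  by move: hp nh; rewrite sc ltr_norml => /andP[? ?] ? ? ? ? ? ? ?; nra.
have rc : 0 < r <= len c.
  rewrite r0 leNgt; apply/negP => lr; have e0 : 0 < r - len c by lra.
  have [p [/= /len_suffix lp]] := filter_ex (filterI Fc (nr _ e0)).
  by have := height_le p; rewrite ltr_norml => ? /andP[? ?]; lra.
exists (pt c r); split=> // U /(nbhs_ptP _ rc)[e e0 h].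
pose e' := Num.min e (r / 2).
have e'0 : 0 < e' by rewrite lt_min e0; lra.
have Fs : F [set p | stem c e' (arm p)].
  have [L hL] := scale_fin P e'0.
  have : F [set p | forall i, i \in L -> ~ suffix (i :: c) (arm p)].
    elim: L {hL} => [|i L IH].
      by apply: filterS filterT => p _ i; rewrite in_nil.
    have [/nF//|h2] := in_ultra_setVsetC [set p | suffix (i :: c) (arm p)] FU.
    apply: filterS (filterI IH h2) => p [h3 h4] j; rewrite inE => /orP[/eqP ->//|].
    exact: h3.
  move=> FL; apply: filterS (filterI Fc FL) => p [/= cp hp].
  have [->|/(suffix_child cp)[i ip]] := pselect (arm p = c); [by left | right].
  exists i => //; rewrite ltNge; apply/negP => /hL /hp; exact.
apply: filterS (filterI Fs (nr _ e'0)) => p [/= sp hp]; apply: h.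
apply: (@closeW _ _ _ _ e'); first by rewrite ge_min lexx.
split=> //; apply: stemW => //.
have : e' <= r / 2 by rewrite ge_min lexx orbT.
by move: hp; rewrite ltr_norml => /andP[? ?] ?; lra.
Qed.

Lemma connected_ivt (f : fan P -> R) A x y r : connected A -> continuous f ->
  A x -> A y -> f x <= r <= f y -> exists2 z, A z & f z = r.
Proof.
move=> cA cf Ax Ay /andP[xr ry].
have /connected_intervalP h := connected_continuous_connected cA (continuous_subspaceT cf).
have fx : (f @` A) (f x) by exists x.
have fy : (f @` A) (f y) by exists y.
by have [|z Az <-] := h _ _ fx fy r; [rewrite xr | exists z].
Qed.

(* Separating the bundle of legs close to leg [c] from the others forces [A]
   to cross the height [r] arbitrarily close to [(c, r)]. *)
Lemma closed_connected_leg A p r : closed A -> connected A -> A top -> A p ->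
  0 <= r <= height p -> A (pt (arm p) r).
Proof.
move=> clA cA At Ap /andP[]; rewrite le_eqVlt => /orP[/eqP <- _|r0 rp].
  by rewrite pt_le0.
apply: clA; set c := arm p in rp *.
have rc : 0 < r <= len c by rewrite r0 (le_trans rp) ?height_le.
move=> U /(nbhs_ptP _ rc)[e e0 h]; pose e' := Num.min e r.
have e'0 : 0 < e' by rewrite lt_min e0.
have cf := branch_height_continuous (branch_stem c e'0).
have [|q Aq] := connected_ivt (r := r) cA cf At Ap.
  rewrite /branch_height height_top if_same; case: asboolP => [_|[]]; last by left.
  by rewrite ltW.
rewrite /branch_height; case: asboolP => [sq hq|_ r0']; last by move: r0; rewrite -r0' ltxx.
exists q; split=> //; apply: h; apply: (@closeW _ _ _ _ e'); first by rewrite ge_min lexx.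
split; first by rewrite hq subrr normr0.
by apply: stemW => //; rewrite hq ge_min lexx orbT.
Qed.

(** The height, counted negatively outside [M], is continuous and vanishes only at the top, so it
    keeps its sign on [A]. *)
Lemma connected_branch A M p q : connected A -> ~ A top -> branch M ->
  A p -> A q -> M (arm p) -> M (arm q).
Proof.
move=> cA At bM Ap Aq Mp; apply: contrapT => Mq.
pose f x := branch_height M x - branch_height (~` M) x.
have cf : continuous f.
  move=> x; apply: (@cvgB _ _ _ _ (nbhs_filter x)); first exact: branch_height_continuous.
  exact/branch_height_continuous/branchC.
have fE x : f x = if `[< M (arm x) >] then height x else - height x.
  rewrite /f /branch_height; case: asboolP => h; case: asboolP => // h'.
    by rewrite subr0.
  by rewrite sub0r.
have [|x Ax] := connected_ivt (r := 0) cA cf Aq Ap.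
  rewrite !fE (asboolF Mq) (asboolT Mp) height_ge0 oppr_le0 height_ge0 //.
rewrite fE; case: ifP => _ => [|/eqP]; last first.
  by rewrite oppr_eq0 => /eqP /height_eq0 xt; rewrite xt in Ax.
by move/height_eq0 => xt; rewrite xt in Ax.
Qed.

Lemma connected_arm A p q : connected A -> ~ A top -> A p -> A q -> arm p = arm q.
Proof.
move=> cA At Ap Aq; apply: suffix_anti.
  by apply: (connected_branch cA At (branch_suffix (arm p)) Ap Aq); exact: suffix_refl.
by apply: (connected_branch cA At (branch_suffix (arm q)) Aq Ap); exact: suffix_refl.
Qed.

Lemma closed_connected_between A p q r : closed A -> connected A -> A p -> A q ->
  arm p = arm q -> height p <= r <= height q -> A (pt (arm q) r).
Proof.
move=> clA cA Ap Aq pq /andP[pr rq].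
have [At|At] := pselect (A top).
  by apply: closed_connected_leg => //; rewrite (le_trans (height_ge0 p)).
have [|x Ax <-] := connected_ivt (r := r) cA (@height_continuous _ P) Ap Aq.
  by rewrite pr rq.
by rewrite (connected_arm cA At Aq Ax) ptK.
Qed.

Definition legpart c (r1 r2 : R) : set (fan P) := pt c @` `[r1, r2].

Lemma legpart_connected c r1 r2 : connected (legpart c r1 r2).
Proof.
apply: connected_continuous_connected; last exact/continuous_subspaceT/pt_continuous.
exact/connected_intervalP/interval_is_interval.
Qed.

Lemma legpart_closed c r1 r2 : closed (legpart c r1 r2).
Proof.
apply: (compact_closed fan_hausdorff); apply: continuous_compact.
  exact/continuous_subspaceT/pt_continuous.
exact: segment_compact.
Qed.

Lemma star_connected A : A top -> (forall p r, A p -> 0 <= r <= height p -> A (pt (arm p) r)) ->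
  connected A.
Proof.
move=> At h; rewrite (_ : A = \bigcup_(p in A) legpart (arm p) 0 (height p)).
  apply: bigcup_connected => [|p _]; last exact: legpart_connected.
  by exists top => p _; exists 0; rewrite ?pt_le0//= in_itv /= lexx height_ge0.
apply/seteqP; split=> [p Ap|_ [p Ap [r rp <-]]].
  by exists p => //; exists (height p); rewrite ?ptK //= in_itv /= lexx height_ge0.
by apply: h => //; move: rp; rewrite /= in_itv.
Qed.

Lemma setT_fan_connected : connected [set: fan P].
Proof. exact: star_connected. Qed.

Lemma fan_continuum : continuum [set: fan P].
Proof. by split; [exists top | exact: fan_compact | exact: setT_fan_connected]. Qed.

(** If both sets contain the top, the intersection is a star of leg segments. Otherwise one of them
    lies on a single leg, and the intersection is an interval of that leg. *)
Lemma connected_setI A B : closed A -> connected A -> closed B -> connected B ->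
  connected (A `&` B).
Proof.
move=> clA cA clB cB; have [[At Bt]|ABt] := pselect ((A `&` B) top).
  by apply: star_connected => // p r [Ap Bp] rp; split; exact: closed_connected_leg.
have [/set0P[p0 [Ap0 Bp0]]|/negP/negPn/eqP ->] := pselect (A `&` B != set0); last first.
  exact: connected0.
set c := arm p0.
have ac p : (A `&` B) p -> arm p = c.
  move=> [Ap Bp]; have [At|At] := pselect (A top).
    have Bt : ~ B top by move=> Bt; exact: ABt.
    exact: (connected_arm cB Bt).
  exact: (connected_arm cA At).
rewrite (_ : A `&` B = pt c @` [set r | 0 < r <= len c /\ (A `&` B) (pt c r)]).
  apply: connected_continuous_connected; last exact/continuous_subspaceT/pt_continuous.
  apply/connected_intervalP => r1 r2 /= [/andP[r10 r1c] [A1 B1]] [/andP[r20 r2c] [A2 B2]].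
  move=> r /andP[r1r rr2]; have rc : 0 < r <= len c.
    by rewrite (lt_le_trans r10) // (le_trans rr2).
  have h12 : height (pt c r1) <= r <= height (pt c r2).
    by rewrite !height_pt ?r1r // ?r1c ?r2c ltW.
  have ar : arm (pt c r1) = arm (pt c r2) by rewrite !arm_pt.
  split=> //; rewrite -[c in pt c r](arm_pt c r20).
  by split; exact: closed_connected_between h12.
apply/seteqP; split=> [p ABp|_ [r [_ h] <-] //].
have pc := ac p ABp; exists (height p); last by rewrite -pc ptK.
rewrite /= -pc ptK; split=> //; rewrite height_le andbT; apply/height_gt0 => pt0.
by rewrite pt0 in ABp.
Qed.

Lemma fan_hereditarily_unicoherent : hereditarily_unicoherent [set: fan P].
Proof.
move=> _ _ _ A B [_ kA cA] [_ kB cB] _.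
by apply: connected_setI => //; apply: compact_closed => //; exact: fan_hausdorff.
Qed.

End FanContinuum.

(** * Arcs and triods *)

Section Arcs.
Context {R : realType} (X : metricType R).
Implicit Types (x y e : X) (A B : set X) (f : R -> X).

Let hX : hausdorff_space X := @metric_hausdorff R X.

Lemma arc_of_injective f : continuous f ->
  (forall u v : R, 0 <= u <= 1 -> 0 <= v <= 1 -> f u = f v -> u = v) ->
  is_arc (f 0) (f 1) (f @` `[0, 1]).
Proof.
move=> cf inj_f; exists f; split=> //.
pose I : set R := `[0, 1]%classic.
pose g y := xget 0 [set z | I z /\ f z = y].
have gP y : (f @` `[0, 1]) y -> I (g y) /\ f (g y) = y.
  by move=> [z z01 fz]; rewrite /g; case: xgetP => [z' _ //|/(_ z) []].
have in01 z : I z -> 0 <= z <= 1 by rewrite /I /= in_itv.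
exists g; split; [split|split; first exact: continuous_subspaceT].
- by move=> z z01; exists z.
- by move=> y /gP[].
- move=> z z01; have [|g01 fg] := gP (f z); first by exists z.
  by apply: inj_f => //; exact: in01.
- by move=> y /gP[].
apply/continuous_closedP => C clC; apply/closed_subspaceP.
exists (f @` (`[0, 1] `&` C)).
  apply: compact_closed => //; apply: continuous_compact; first exact: continuous_subspaceT.
  by apply: compact_closedI => //; exact: segment_compact.
apply/seteqP; split=> [_ [[z [z01 Cz] <-] _]|y [/= Cy Ay]].
  split; last by exists z.
  have [|g01 fg] := gP (f z); first by exists z.
  by change (C (g (f z))); rewrite (inj_f _ _ (in01 _ g01) (in01 _ z01) fg).
by split=> //; exists (g y); have [] := gP y Ay.
Qed.

Lemma arc_continuum x y A : is_arc x y A -> [/\ closed A, connected A, A x & A y].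
Proof.
move=> [f [[g [[AB BA gf fg] [cf cg]]] <- <-]].
have fA : f @` `[0, 1] = A.
  apply/seteqP; split=> [_ [z z01 <-]|a Aa]; first exact: AB.
  by exists (g a); [exact: BA | exact: fg].
split.
- rewrite -fA; apply: compact_closed => //; apply: continuous_compact => //.
  exact: segment_compact.
- rewrite -fA; apply: connected_continuous_connected => //.
  exact/connected_intervalP/interval_is_interval.
- by apply: AB; rewrite /= in_itv /= lexx ler01.
- by apply: AB; rewrite /= in_itv /= lexx ler01.
Qed.

(** Pulled back to the unit interval, [B] is an interval containing both ends. This serves to
    identify arcs: a connected subset with the same ends is the whole arc. *)
Lemma arc_minimal x y A B : is_arc x y A -> B `<=` A -> connected B -> B x -> B y -> B = A.
Proof.
move=> [f [[g [[AB BA gf fg] [cf cg]]] <- <-]] sBA cB B0 B1.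
apply/seteqP; split=> // a Aa.
have /connected_intervalP h : connected (g @` B).
  by apply: connected_continuous_connected cB _; exact: continuous_subspaceW cg.
have g0 : (g @` B) 0 by exists (f 0) => //; rewrite gf //= in_itv /= lexx ler01.
have g1 : (g @` B) 1 by exists (f 1) => //; rewrite gf //= in_itv /= lexx ler01.
have := BA _ Aa; rewrite /= in_itv /= => ga; have [b Bb gba] := h _ _ g0 g1 _ ga.
by rewrite -(fg a Aa) -gba fg //; exact: sBA.
Qed.

End Arcs.

(** * Prongs as topological invariants of points *)

Section Prongs.
Context {T : topologicalType}.
Implicit Types (x : T) (A B C : set T).

(** Arcs issuing from [x], weakened to nondegenerate closed connected sets; these are directly
    carried over by homeomorphisms and easy to analyse in the fan. *)
Definition prong x A := [/\ closed A, connected A, A x & exists2 y, A y & y <> x].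

Definition two_pronged x := exists A B, [/\ prong x A, prong x B & A `&` B = [set x]].

Definition three_pronged x := exists A B C, [/\ prong x A, prong x B & prong x C] /\
  [/\ A `&` B = [set x], A `&` C = [set x] & B `&` C = [set x]].

(* The set [A] has to be closed: a fan may remain connected when an inner point
   of a leg is removed, if this point is a limit of endpoints. *)
Definition beyond t x y := forall A, closed A -> connected A -> A t -> A y -> A x.

End Prongs.

Section HomeoInvariance.
Context {T : topologicalType} (h : T -> T).
Hypothesis hh : homeomorphism h.

Lemma homeo_image_closed (A : set T) : closed A -> closed (h @` A).
Proof.
have [g [hg gh ch cg]] := hh; move=> cA.
have -> : h @` A = g @^-1` A.
  apply/seteqP; split=> [_ [a Aa <-]|b Ab]; first by rewrite /= hg.
  by exists (g b).
by move/continuous_closedP: cg; apply.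
Qed.

Lemma homeo_image_connected (A : set T) : connected A -> connected (h @` A).
Proof.
have [g [hg gh ch cg]] := hh; move=> cA.
by apply: connected_continuous_connected => //; exact: continuous_subspaceT.
Qed.

Lemma homeo_inj : injective h.
Proof. by have [g [hg _ _ _]] := hh; exact: can_inj hg. Qed.

Lemma homeo_prong x A : prong x A -> prong (h x) (h @` A).
Proof.
move=> [clA cA Ax [y Ay yx]]; split.
- exact: homeo_image_closed.
- exact: homeo_image_connected.
- by exists x.
- by exists (h y); [exists y | move/homeo_inj].
Qed.

Lemma homeo_imageI1 x (A B : set T) : A `&` B = [set x] -> h @` A `&` h @` B = [set h x].
Proof.
move=> AB; have : (A `&` B) x by rewrite AB.
move=> [Ax Bx]; apply/seteqP; split=> [_ [[a Aa <-] [b Bb /homeo_inj ba]]|_ ->].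
  by have : (A `&` B) a by [split=> //; rewrite -ba]; rewrite AB => ->.
by split; exists x.
Qed.

Lemma homeo_two_pronged x : two_pronged x -> two_pronged (h x).
Proof.
move=> [A [B [pA pB AB]]]; exists (h @` A), (h @` B).
by split; [exact: homeo_prong | exact: homeo_prong | exact: homeo_imageI1].
Qed.

Lemma homeo_three_pronged x : three_pronged x -> three_pronged (h x).
Proof.
move=> [A [B [C [[pA pB pC] [AB AC BC]]]]]; exists (h @` A), (h @` B), (h @` C).
by split; split; (exact: homeo_prong || exact: homeo_imageI1).
Qed.

Lemma homeo_beyond t x y : beyond t x y -> beyond (h t) (h x) (h y).
Proof.
have [g [hg gh ch cg]] := hh; move=> txy A clA cA At Ay.
have cl' : closed (h @^-1` A) by move/continuous_closedP: ch; apply.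
suff : (h @^-1` A) x by [].
apply: txy => //.
rewrite (_ : h @^-1` A = g @` A); last first.
  apply/seteqP; split=> [a Aa|_ [a Aa <-]]; last by rewrite /= gh.
  by exists (h a).
by apply: connected_continuous_connected => //; exact: continuous_subspaceT.
Qed.

Lemma homeo_closure (A B : set T) x : (forall y, A y -> B (h y)) -> closure A x -> closure B (h x).
Proof.
have [g [hg gh ch cg]] := hh; move=> AB clx U /ch /clx[y [Ay Uy]].
by exists (h y); split=> //; exact: AB.
Qed.

End HomeoInvariance.

(** * Orbits of the homeomorphism group *)

Section Homeo.
Context {T : topologicalType}.
Implicit Types h k : T -> T.

Lemma homeo_id : homeomorphism (@id T).
Proof. by exists id; split=> // x; exact: cvg_id. Qed.

Lemma homeo_inv h : homeomorphism h -> exists g, [/\ homeomorphism g, cancel h g & cancel g h].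
Proof. by move=> [g [hg gh ch cg]]; exists g; split=> //; exists h. Qed.

Lemma homeo_comp h k : homeomorphism h -> homeomorphism k -> homeomorphism (k \o h).
Proof.
move=> [g [hg gh ch cg]] [l [kl lk ck cl]]; exists (g \o l); split.
- exact: can_comp.
- exact: can_comp.
- by move=> x; apply: continuous_comp; [exact: ch | exact: ck].
- by move=> x; apply: continuous_comp; [exact: cl | exact: cg].
Qed.

Definition same_orbit (x y : T) := exists h : T -> T, homeomorphism h /\ h x = y.

Lemma same_orbit_refl x : same_orbit x x.
Proof. by exists id; split=> //; exact: homeo_id. Qed.

Lemma same_orbit_sym x y : same_orbit x y -> same_orbit y x.
Proof. by move=> [h [/homeo_inv[g [hg hK _]] <-]]; exists g; split. Qed.

Lemma same_orbit_trans y x z : same_orbit x y -> same_orbit y z -> same_orbit x z.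
Proof.
by move=> [h [hh <-]] [k [hk <-]]; exists (k \o h); split=> //; exact: homeo_comp.
Qed.

Lemma homeo_of_compact h : hausdorff_space T -> compact [set: T] ->
  continuous h -> injective h -> (forall y, exists x, h x = y) -> homeomorphism h.
Proof.
move=> hT kT ch ih /choice[g gh]; exists g; split=> //; first by move=> x; exact: ih.
apply/continuous_closedP => C clC.
rewrite (_ : g @^-1` C = h @` C).
  apply: compact_closed => //; apply: continuous_compact; first exact: continuous_subspaceT.
  exact: subclosed_compact clC kT _.
apply/seteqP; split=> [y Cy|_ [x Cx <-]]; first by exists (g y).
by rewrite /= (_ : g (h x) = x) //; exact: ih.
Qed.

(** Minimality is the pigeonhole principle: a piece of a homogeneous partition contains at most one
    representative. *)
Lemma fractionally_homogeneous_reps n (rep : 'I_n -> T) :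
  (forall x, exists i, same_orbit x (rep i)) ->
  (forall i j, same_orbit (rep i) (rep j) -> i = j) -> fractionally_homogeneous T n.
Proof.
move=> hrep hinj; split=> [|m mn [Q [[covQ _ _] hQ]]].
  exists (fun i => [set x | same_orbit x (rep i)]); split; first split.
  - by apply/seteqP; split=> // x _; have [i hi] := hrep x; exists i.
  - move=> i j _ _ [x [/= xi xj]]; apply: hinj.
    exact: same_orbit_trans (same_orbit_sym xi) xj.
  - by move=> i _; exists (rep i); exact: same_orbit_refl.
  - by move=> i x y /= xi /same_orbit_sym; exact: same_orbit_trans.
have /choice[k hk] : forall i : 'I_n, exists j : 'I_m, Q j (rep i).
  move=> i; have : cover [set: 'I_m] Q (rep i) by rewrite covQ.
  by move=> [j _ Qj]; exists j.
have ik : injective k.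
  by move=> i j kij; apply: hinj; apply: hQ (hk i) _; rewrite kij.
by have := leq_card k ik; rewrite !card_ord leqNgt mn.
Qed.

End Homeo.

(** * Arcs and prongs in the fan *)

Section FanArcs.
Context {R : realType} (P : fan_spec R).
Notation word := (seq (letter P)).
Implicit Types (s c : word) (i j : letter P) (p x y : fan P) (r e u v : R) (A B : set (fan P)).

Lemma arc_path (f : R -> fan P) (a b : R) : a < b ->
  (forall u v, u <= v -> dist (f u) (f v) <= v - u) ->
  (forall u v, a <= u <= b -> a <= v <= b -> f u = f v -> u = v) ->
  is_arc (f a) (f b) (f @` `[a, b]).
Proof.
move=> ab lip inj_f; pose l z := a + (b - a) * z.
have ba : 0 < b - a by rewrite subr_gt0.
have := @arc_of_injective R (fan P) (f \o l).
have -> : (f \o l) 0 = f a by rewrite /= /l mulr0 addr0.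
have -> : (f \o l) 1 = f b by rewrite /= /l mulr1 addrC subrK.
move=> h.
rewrite (_ : f @` `[a, b] = (f \o l) @` `[0, 1]); last first.
  apply/seteqP; split=> _ [z + <-]; rewrite /= in_itv /= => /andP[z0 z1].
    exists ((z - a) / (b - a)).
      rewrite /= in_itv /= divr_ge0 ?subr_ge0 ?(ltW ab) //=.
      by rewrite ler_pdivrMr // mul1r lerD2r.
    by rewrite /= /l mulrCA divff ?gt_eqF // mulr1 addrC subrK.
  by exists (l z); rewrite //= in_itv /= /l; apply/andP; split; nra.
apply: h => [z|u v u01 v01 /inj_f e]; last first.
  have {}e : l u = l v by apply: e; rewrite /l; apply/andP; split; nra.
  by move: e => /addrI/mulfI; apply; rewrite gt_eqF.
apply/cvg_ballP => e e0; apply/nbhs_ballP.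
exists (e / (b - a)); first by rewrite /= divr_gt0.
move=> v zv; have {zv} : `|z - v| * (b - a) < e by rewrite -ltr_pdivlMr.
rewrite fan_ballE /=; apply: le_lt_trans; have [uv|/ltW vu] := leP z v.
  rewrite distrC ger0_norm ?subr_ge0 //; have h1 : l z <= l v by rewrite /l; nra.
  by apply: le_trans (lip _ _ h1) _; rewrite /l; lra.
rewrite ger0_norm ?subr_ge0 // dist_sym; have h1 : l v <= l z by rewrite /l; nra.
by apply: le_trans (lip _ _ h1) _; rewrite /l; lra.
Qed.

Lemma pt_inj c r r' : 0 <= r <= len c -> 0 <= r' <= len c -> pt c r = pt c r' -> r = r'.
Proof. by move=> h h' e; rewrite -(height_pt h) e height_pt. Qed.

Lemma arc_legpart c r r' : 0 <= r -> r < r' -> r' <= len c ->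
  is_arc (pt c r) (pt c r') (legpart c r r').
Proof.
move=> r0 rr rc; apply: arc_path => // [u v uv|u v /andP[? ?] /andP[? ?]].
  by apply: le_trans (dist_pt _ _ _) _; rewrite distrC ger0_norm ?subr_ge0.
by apply: pt_inj; apply/andP; split; lra.
Qed.

Lemma arc_legpart_rev c r r' : 0 <= r -> r < r' -> r' <= len c ->
  exists A, is_arc (pt c r') (pt c r) A.
Proof.
move=> r0 rr rc.
have := @arc_path (pt c \o -%R) (- r') (- r); rewrite /= !opprK => h.
eexists; apply: h => [|u v uv|u v /andP[? ?] /andP[? ?]]; first by rewrite ltrN2.
  by apply: le_trans (dist_pt _ _ _) _; rewrite opprK addrC ger0_norm ?subr_ge0.
by move/pt_inj => e; apply: oppr_inj; apply: e; apply/andP; split; lra.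
Qed.

Lemma arc_cross c c' r r' : c != c' -> 0 < r <= len c -> 0 < r' <= len c' ->
  exists2 A, is_arc (pt c r) (pt c' r') A & A top.
Proof.
move=> cc /andP[r0 rc] /andP[r'0 rc'].
(* Negative times run down leg [c], positive ones up leg [c'], and time 0 is the top. *)
pose f (z : R) := if z <= 0 then pt c (- z) else pt c' z.
have := @arc_path f (- r) r'; have -> : f (- r) = pt c r by rewrite /f oppr_le0 (ltW r0) opprK.
have -> : f r' = pt c' r' by rewrite /f leNgt r'0.
move=> h.
exists (f @` `[- r, r']); last first.
  by exists 0; rewrite /f ?lexx ?oppr0 ?pt_le0 // /= in_itv /= oppr_le0 !ltW.
apply: h => [|u v uv|u v /andP[u1 u2] /andP[v1 v2]]; first by lra.
  rewrite /f; have [u0|u0] := leP u 0; have [v0|v0] := leP v 0; last 2 first.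
  - by exfalso; lra.
  - by apply: le_trans (dist_pt _ _ _) _; rewrite distrC ger0_norm ?subr_ge0.
  - by apply: le_trans (dist_pt _ _ _) _; rewrite opprK addrC ger0_norm ?subr_ge0.
  apply: le_trans (dist_triangle top _ _) _; rewrite addrC; apply: lerD.
    have := dist_pt c' 0 v; rewrite pt_le0 // sub0r normrN ger0_norm // ltW //.
  have := dist_pt c (- u) 0; rewrite (pt_le0 _ (lexx 0)) subr0 ger0_norm //.
  by rewrite oppr_ge0.
rewrite /f; have [u0|u0] := leP u 0; have [v0|v0] := leP v 0.
- by move/pt_inj => e; apply: oppr_inj; apply: e; apply/andP; split; lra.
- move=> e; exfalso; have [u00|u00] := eqVneq u 0.
    move: e; rewrite u00 oppr0 pt_le0 // => /(congr1 (@height R P)).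
    by rewrite height_pt ?height_top; [lra | apply/andP; split; lra].
  have u1' : 0 < - u by rewrite oppr_gt0 lt_neqAle u00.
  by move: e => /(congr1 (@arm R P)) /eqP; rewrite !arm_pt // (negbTE cc).
- move=> e; exfalso; have [v00|v00] := eqVneq v 0.
    move: e; rewrite v00 oppr0 (pt_le0 _ (lexx 0)) => /(congr1 (@height R P)).
    by rewrite height_pt ?height_top; [lra | apply/andP; split; lra].
  have v1' : 0 < - v by rewrite oppr_gt0 lt_neqAle v00.
  by move: e => /(congr1 (@arm R P)) /eqP; rewrite !arm_pt // eq_sym (negbTE cc).
- by apply: pt_inj; apply/andP; split; lra.
Qed.

Lemma fan_arcwise_connected : arcwise_connected (fan P).
Proof.
have tp p : p <> top -> exists A, is_arc top p A.
  move=> /height_gt0 p0; have := @arc_legpart (arm p) 0 (height p) (lexx 0) p0 (height_le p).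
  by rewrite pt_le0 // ptK; exists (legpart (arm p) 0 (height p)).
have pt' p : p <> top -> exists A, is_arc p top A.
  move=> /height_gt0 p0; have := @arc_legpart_rev (arm p) 0 (height p) (lexx 0) p0 (height_le p).
  by rewrite (pt_le0 _ (lexx 0)) ptK.
move=> x y; have [->|xt] := pselect (x = top); first by move/nesym; exact: tp.
have [->|yt] := pselect (y = top); first by move=> _; exact: pt'.
move: xt yt => /height_gt0 x0 /height_gt0 y0 xy.
have [e|ne] := eqVneq (arm x) (arm y); last first.
  have := @arc_cross _ _ (height x) (height y) ne.
  by rewrite x0 y0 !height_le !ptK => /(_ isT isT)[A]; exists A.
have [h|h|h] := ltgtP (height x) (height y); last by case: xy; exact: fan_eq.
  have hy : height y <= len (arm x) by rewrite e height_le.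
  have := arc_legpart (ltW x0) h hy.
  by rewrite ptK e ptK; exists (legpart (arm y) (height x) (height y)).
have := @arc_legpart_rev (arm x) _ _ (ltW y0) h (height_le x).
by rewrite ptK e ptK.
Qed.

Lemma fan_dendroid : dendroid (fan P).
Proof.
split; [exact: fan_continuum | exact: fan_arcwise_connected |].
exact: fan_hereditarily_unicoherent.
Qed.

Definition goes_down x A := exists2 r0, 0 <= r0 < height x &
  forall r, r0 <= r <= height x -> A (pt (arm x) r).

Definition goes_up x A := exists2 r0, height x < r0 <= len (arm x) &
  forall r, height x <= r <= r0 -> A (pt (arm x) r).

(** A prong through the top contains the whole leg below [x]. Any other stays on the leg of [x],
    where its second point decides the direction. *)
Lemma prong_direction x A : x <> top -> prong x A -> goes_down x A \/ goes_up x A.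
Proof.
move=> /height_gt0 x0 [clA cA Ax [y Ay yx]]; have [At|At] := pselect (A top).
  left; exists 0; first by rewrite lexx.
  by move=> r; exact: closed_connected_leg.
have yxa := connected_arm cA At Ay Ax.
have y0 : 0 < height y by apply/height_gt0 => yt; rewrite yt in Ay.
have [h|h|h] := ltgtP (height y) (height x).
- left; exists (height y); first by rewrite ltW.
  by move=> r; exact: closed_connected_between.
- right; exists (height y); first by rewrite h -yxa height_le.
  by rewrite -yxa => r; exact: closed_connected_between.
- by case: yx; exact: fan_eq.
Qed.

Lemma not_down_down x A B : x <> top -> goes_down x A -> goes_down x B ->
  A `&` B <> [set x].
Proof.
move=> /height_gt0 x0 [a /andP[a0 ax] hA] [b /andP[b0 bx] hB] AB.
pose m := Num.max a b; have mx : m < height x by rewrite gt_max ax.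
have : (A `&` B) (pt (arm x) m).
  by split; [apply: hA | apply: hB]; rewrite (ltW mx) le_max lexx ?orbT.
rewrite AB => /(congr1 (@height R P)); rewrite height_pt; first lra.
by rewrite le_max a0 (le_trans (ltW mx)) ?height_le.
Qed.

Lemma not_up_up x A B : goes_up x A -> goes_up x B -> A `&` B <> [set x].
Proof.
have x0 := height_ge0 x.
move=> [a /andP[xa al] hA] [b /andP[xb bl] hB] AB.
pose m := Num.min a b; have xm : height x < m by rewrite lt_min xa.
have : (A `&` B) (pt (arm x) m).
  by split; [apply: hA | apply: hB]; rewrite (ltW xm) ge_min lexx ?orbT.
rewrite AB => /(congr1 (@height R P)); rewrite height_pt; first lra.
by rewrite (le_trans x0 (ltW xm)) ge_min al.
Qed.

(** Off the top there are only two directions, so two of three prongs share one and overlap in a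
    segment. *)
Lemma three_pronged_top x : three_pronged x -> x = top.
Proof.
move=> [A [B [C [[pA pB pC] [AB AC BC]]]]]; apply: contrapT => xt.
have [dA|uA] := prong_direction xt pA; have [dB|uB] := prong_direction xt pB;
  have [dC|uC] := prong_direction xt pC;
  try by [exact: (not_down_down xt dA dB) | exact: (not_down_down xt dA dC)
  | exact: (not_down_down xt dB dC) | exact: (not_up_up uA uB)
  | exact: (not_up_up uA uC) | exact: (not_up_up uB uC)].
Qed.

Definition tip_pt c := pt c (len c).

Lemma tip_pt_neq_top c : tip_pt c <> top.
Proof. by apply/height_gt0; rewrite height_pt ?len_gt0 // lexx ltW ?len_gt0. Qed.

Lemma tip_not_two_pronged c : ~ two_pronged (tip_pt c).
Proof.
have h : height (tip_pt c) = len c by rewrite height_pt // lexx ltW ?len_gt0.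
have ha : arm (tip_pt c) = c by rewrite arm_pt // len_gt0.
have nu A : ~ goes_up (tip_pt c) A by move=> [r]; rewrite h ha => /andP[? ?]; exfalso; lra.
have tt := @tip_pt_neq_top c.
move=> [A [B [pA pB]]]; have [dA|/nu//] := prong_direction tt pA.
by have [dB|/nu//] := prong_direction tt pB; exact: not_down_down.
Qed.

End FanArcs.

Section ArcProngs.
Context {R : realType} (X : metricType R).
Implicit Types (x y e : X) (A B : set X).

Lemma arc_neq x y A : is_arc x y A -> y <> x.
Proof.
move=> [f [[g [[AB BA gf fg] _]] <- <-]] e; have := gf 0; rewrite -e gf.
  by move=> /(_ _)/eqP; rewrite oner_eq0 => /(_ _)/notF; apply; rewrite /= in_itv /= lexx ler01.
by rewrite /= in_itv /= lexx ler01.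
Qed.

Lemma arc_prong x y A : is_arc x y A -> prong x A.
Proof.
by move=> xyA; have [? ? ? Ay] := arc_continuum xyA; split=> //; exists y => //; exact: arc_neq xyA.
Qed.

Lemma arc_interior_two_pronged x y e A : is_arc x y A -> A e -> e <> x -> e <> y ->
  two_pronged e.
Proof.
move=> [f [[g [[AB BA gf fg] [cf cg]]] <- <-]] Ae ex ey.
have : (`[0, 1]%classic : set R) (g e) by exact: BA.
have fge := fg e Ae; rewrite /= in_itv /= => /andP[]; set z := g e in fge *.
rewrite le_eqVlt => /orP[/eqP z0|z0]; first by case: ex; rewrite -fge z0.
rewrite le_eqVlt => /orP[/eqP z1|z1]; first by case: ey; rewrite -fge z1.
have sub a b : 0 <= a -> b <= 1 -> (`[a, b]%classic : set R) `<=` `[0, 1].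
  by move=> a0 b1 w /=; rewrite !in_itv /= => /andP[? ?]; apply/andP; split; lra.
have pr a b w : 0 <= a -> b <= 1 -> a <= w <= b -> w != z -> a <= z <= b ->
    prong e (f @` `[a, b]).
  move=> a0 b1 wab wz zab; have cab := continuous_subspaceW (sub a b a0 b1) cf.
  split.
  - apply: compact_closed; first exact: metric_hausdorff.
    by apply: continuous_compact => //; exact: segment_compact.
  - apply: connected_continuous_connected => //.
    exact/connected_intervalP/interval_is_interval.
  - by exists z; rewrite //= in_itv.
  - exists (f w); first by exists w; rewrite //= in_itv.
    move=> fw; case/eqP: wz; rewrite -[LHS]gf ?fw //.
    by apply: (sub a b) => //=; rewrite in_itv.
exists (f @` `[0, z]), (f @` `[z, 1]); split.
- by apply: (@pr _ _ 0) => //; rewrite ?lexx ?(ltW z0) ?(ltW z1) // lt_eqF.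
- by apply: (@pr _ _ 1) => //; rewrite ?lexx ?(ltW z0) ?(ltW z1) // gt_eqF.
apply/seteqP; split=> [_ [[a + <-] [b + fab]]|_ ->]; last first.
  by split; exists z; rewrite //= in_itv /= ?lexx ?(ltW z0) ?(ltW z1).
rewrite /= !in_itv /= => /andP[a0 az] /andP[zb b1].
have e1 : b = a by rewrite -[LHS]gf -1?[RHS]gf ?fab //= in_itv /=; apply/andP; split; lra.
by rewrite -fge; congr f; lra.
Qed.

Lemma simple_triod_three_pronged t (T : set X) : simple_triod t T -> three_pronged t.
Proof.
move=> [a [b [c [A [B [C [[/arc_prong pA /arc_prong pB /arc_prong pC] [? ? ? _]]]]]]]].
by exists A, B, C.
Qed.

End ArcProngs.

(** * The ramification point, the endpoints, and smoothness *)

Section FanShape.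
Context {R : realType} (P : fan_spec R) (i0 : letter P).
Notation word := (seq (letter P)).
Implicit Types (s c : word) (i j : letter P) (p x y : fan P) (r e u v : R) (A B : set (fan P)).

Lemma arc_to_tip c : is_arc top (tip_pt c) (legpart c 0 (len c)).
Proof. by have := @arc_legpart _ P c 0 (len c) (lexx 0) (len_gt0 c) (lexx _); rewrite pt_le0. Qed.

Lemma legpartI c c' r r' : c != c' -> 0 <= r -> 0 <= r' ->
  legpart c 0 r `&` legpart c' 0 r' = [set (top : fan P)].
Proof.
move=> cc r0 r'0; apply/seteqP; split=> [_ [[a + <-] [b + ab]]|_ ->]; last first.
  by split; exists 0; rewrite ?pt_le0 //= in_itv /= lexx.
rewrite /= !in_itv /= => /andP[a0 _] /andP[b0 _].
have [aa|a00] := leP a 0; first by rewrite pt_le0.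
have [bb|b00] := leP b 0; first by rewrite -ab pt_le0.
by move: ab => /(congr1 (@arm R P)) /eqP; rewrite !arm_pt // eq_sym (negbTE cc).
Qed.

Lemma top_ramification : ramification_point (top : fan P).
Proof.
pose L c := legpart (P := P) c 0 (len c).
exists (L [::] `|` L [:: i0] `|` L [:: i0; i0]).
exists (tip_pt [::]), (tip_pt [:: i0]), (tip_pt [:: i0; i0]), (L [::]), (L [:: i0]), (L [:: i0; i0]).
split; split=> //; try exact: arc_to_tip.
- by apply: legpartI; rewrite ?ltW ?len_gt0.
- by apply: legpartI; rewrite ?ltW ?len_gt0.
- apply: legpartI; rewrite ?ltW ?len_gt0 //.
  by rewrite eqseq_cons andbF.
Qed.

Lemma fan_fan_with_top : fan_with_top (top : fan P).
Proof.
split; first exact: fan_dendroid.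
apply/seteqP; split=> [x [T /simple_triod_three_pronged]|_ ->]; last exact: top_ramification.
exact: three_pronged_top.
Qed.

Lemma top_three_pronged : three_pronged (top : fan P).
Proof. by have [T /simple_triod_three_pronged] := top_ramification. Qed.

Lemma inner_two_pronged p : (forall c, p <> tip_pt c) -> two_pronged p.
Proof.
move=> np; have [->|pt0] := pselect (p = top).
  have [A [B [_ [[? ? _] [? _ _]]]]] := top_three_pronged.
  by exists A, B.
apply: (arc_interior_two_pronged (arc_to_tip (arm p))) => //.
by exists (height p); rewrite ?ptK //= in_itv /= height_ge0 height_le.
Qed.

(** Singles out the tips in terms that homeomorphisms preserve, and with them the limits of
    endpoints. *)
Lemma two_prongedE p : two_pronged p <-> forall c, p <> tip_pt c.
Proof.
split=> [h c e|]; last exact: inner_two_pronged.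
by move: h; rewrite e; exact: tip_not_two_pronged.
Qed.

Lemma endpoint_tip p : endpoint p -> exists c, p = tip_pt c.
Proof.
move=> ep; apply: contrapT => np; have {}np c : p <> tip_pt c by move=> e; apply: np; exists c.
have [pt0|pt0] := pselect (p = top); last first.
  have [//|//|] := ep _ _ _ (arc_to_tip (arm p)).
    by exists (height p); rewrite ?ptK //= in_itv /= height_ge0 height_le.
  exact: np.
have h c : 0 < len (P := P) c <= len c by rewrite len_gt0 lexx.
have [A xyA At] := @arc_cross _ P [::] [:: i0] _ _ isT (h _) (h _).
by rewrite pt0 in np ep; have [] := ep _ _ _ xyA At => /np.
Qed.

(** Whichever arc is chosen, it is closed, connected and contains the top and [p], hence the leg
    below [p]; by minimality it is nothing more. *)
Lemma fan_arc_segment p : arc_segment top p = legpart (arm p) 0 (height p).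
Proof.
rewrite /arc_segment; case: eqVneq => [<-|/eqP/nesym pt0].
  apply/seteqP; split=> [_ ->|_ [z + <-]].
    by exists 0; rewrite ?pt_le0 //= in_itv /= lexx.
  by rewrite /= in_itv /= height_top => /andP[_ z0]; rewrite pt_le0.
have p0 : 0 < height p by apply/height_gt0.
have pA : is_arc top p (legpart (arm p) 0 (height p)).
  have := arc_legpart (lexx 0) p0 (height_le p).
  by rewrite pt_le0 // ptK.
case: xgetP => [A _ /= tA|/(_ _ pA)//].
have [clA cA At Ap] := arc_continuum tA.
apply/esym; apply: (arc_minimal tA).
- by move=> _ [z + <-]; rewrite /= in_itv /=; exact: closed_connected_leg.
- exact: legpart_connected.
- by exists 0; rewrite ?pt_le0 //= in_itv /= lexx ltW.
- by exists (height p); rewrite ?ptK //= in_itv /= lexx ltW.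
Qed.

(* Cutting both points down to height [z] is a contraction, as every coordinate
   of a point is a minimum involving its height. *)
Lemma dist_truncate x y z : 0 <= z ->
  dist (pt (arm x) (Num.min (height x) z)) (pt (arm y) (Num.min (height y) z)) <= dist x y.
Proof.
move=> z0; apply: dist_le => u.
have co p : coord (pt (arm p) (Num.min (height p) z)) u = Num.min (coord p u) z.
  have [m0|m0] := leP (Num.min (height p) z) 0.
    rewrite pt_le0 // coord_top; apply/esym/eqP; rewrite eq_le; apply/andP; split.
      apply: le_trans m0; rewrite le_min !ge_min lexx orbT andbT.
      by rewrite coord_le.
    by rewrite le_min coord_ge0.
  rewrite /coord arm_pt // height_pt; last first.
    by rewrite (ltW m0) ge_min height_le.
  case: ifP => _; first by rewrite minAC.
  by apply/esym/min_idPl.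
rewrite !co; apply: le_trans (ler_norm_min _ _ _) _; exact: dist_coord.
Qed.

Lemma hausdorff_dist_le x y :
  0 <= hausdorff_dist (arc_segment top x) (arc_segment top y) <= dist x y.
Proof.
have near (a b : fan P) (d : R) : dist a b < d -> arc_segment top a `<=` metric_thickening d (arc_segment top b).
  move=> abd; rewrite !fan_arc_segment => _ [z + <-]; rewrite /= in_itv /= => /andP[z0 za].
  exists (pt (arm b) (Num.min (height b) z)).
    exists (Num.min (height b) z) => //.
    by rewrite /= in_itv /= le_min height_ge0 z0 ge_min lexx.
  rewrite fan_ballE /= dist_sym; apply: le_lt_trans abd.
  by have := dist_truncate a b z0; rewrite (min_idPr za).
have mem (d : R) : dist x y < d -> [/\ 0 < d,
    arc_segment top x `<=` metric_thickening d (arc_segment top y) &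
    arc_segment top y `<=` metric_thickening d (arc_segment top x)].
  move=> xyd; split; first exact: le_lt_trans (mdist_ge0 x y) xyd.
    exact: near.
  by apply: near; rewrite dist_sym.
apply/andP; split.
  apply: lb_le_inf => [|d [/ltW //]].
  by exists (dist x y + 1); apply: mem; rewrite ltrDl.
apply/ler_addgt0Pr => e e0; apply: ge_inf; last by apply: mem; rewrite ltrDl.
by exists 0 => d [/ltW].
Qed.

Lemma fan_smooth : smooth_fan (fan P).
Proof.
exists top; split; first exact: fan_fan_with_top.
move=> w x wx; apply/cvgrPdist_lt => e e0.
have xw := wx _ (nbhsx_ballx x e e0).
apply: (@filterS _ \oo _ _ _ _ xw) => n; rewrite /= fan_ballE /= => xwe.
have /andP[h0 h1] := hausdorff_dist_le (w n) x.
rewrite sub0r normrN ger0_norm //; apply: le_lt_trans h1 _.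
by rewrite dist_sym.
Qed.

End FanShape.

(** * Homeomorphisms of the fan *)

Section BuildHomeo.
Context {R : realType} (P : fan_spec R).
Notation word := (seq (letter P)).
Implicit Types (s c : word) (i j : letter P) (p x y : fan P) (r e u v d : R).
Variables (b b' : word -> word) (f : word -> R -> R).
Hypothesis bK : cancel b b'.
Hypothesis b'K : cancel b' b.
Hypothesis f_continuous : forall s, continuous (f s).
Hypothesis f_mono : forall s u v, 0 <= u -> u < v -> v <= len s -> f s u < f s v.
Hypothesis f_0 : forall s, f s 0 = 0.
Hypothesis f_len : forall s, f s (len s) = len (b s).
(** Continuity at leg [c]: children close to [c] become children close to [b c], and move almost as
    [c] does. The hypothesis [f_small] is continuity at the top, uniform over all legs. *)
Hypothesis f_child : forall c e, 0 < e -> exists2 d, 0 < d & forall i, scale i < d ->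
  exists j, [/\ b (i :: c) = j :: b c, scale j < e &
    forall r, 0 <= r <= len (i :: c) -> `|f (i :: c) r - f c r| < e].
Hypothesis f_small : forall e, 0 < e -> exists2 d, 0 < d &
  forall s r, 0 <= r <= len s -> r < d -> f s r < e.

Definition leg_map p := pt (b (arm p)) (f (arm p) (height p)).

Lemma leg_map_pt c r : 0 <= r <= len c -> leg_map (pt c r) = pt (b c) (f c r).
Proof.
move=> /andP[]; rewrite le_eqVlt => /orP[/eqP <- _|r0 rc].
  by rewrite f_0 !pt_le0 // /leg_map f_0 pt_le0.
by rewrite /leg_map arm_pt // height_pt // ltW.
Qed.

Lemma f_gt0 c r : 0 < r <= len c -> 0 < f c r.
Proof. by move=> /andP[r0 rc]; rewrite -(f_0 c); exact: f_mono. Qed.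

Lemma f_le c r : 0 <= r <= len c -> f c r <= len (b c).
Proof.
move=> /andP[r0]; rewrite le_eqVlt -f_len => /orP[/eqP -> //|rc].
by apply: ltW; exact: f_mono.
Qed.

Lemma leg_map_continuous : continuous leg_map.
Proof.
apply: fan_ind => [|c r rc] U.
  have -> : leg_map top = top by rewrite /leg_map f_0 pt_le0.
  move=> /nbhs_topP[e e0 h]; have [d d0 dh] := f_small e0.
  apply/nbhs_topP; exists d => // p pd; apply: h; rewrite /leg_map.
  have hp : 0 <= height p <= len (arm p) by rewrite height_ge0 height_le.
  have [q0|q0] := leP (f (arm p) (height p)) 0; first by rewrite pt_le0.
  by rewrite height_pt ?(ltW q0) ?f_le //; exact: dh.
have /andP[r0 rl] := rc.
have rc' : 0 <= r <= len c by rewrite ltW.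
have fr : 0 < f c r <= len (b c) by rewrite f_gt0 // f_le.
rewrite leg_map_pt // => /(nbhs_ptP _ fr)[e e0 h].
have e20 : 0 < e / 2 by lra.
have [d1 d10 h1] : exists2 d, 0 < d & forall z, `|r - z| < d -> `|f c r - f c z| < e / 2.
  have /cvgrPdist_lt/(_ _ e20)/nbhs_ballP[d /= d0 dh] : f c z @[z --> r] --> f c r.
    exact: f_continuous.
  by exists d => // z; exact: dh.
have [d2 d20 h2] := f_child c e20.
apply/(nbhs_ptP _ rc); exists (Num.min r (Num.min d1 d2)); first by rewrite !lt_min r0 d10.
move=> p [hp ap]; apply: h; move: hp; rewrite !lt_min => /andP[hr /andP[hd1 _]].
have p0 : 0 < height p by move: hr; rewrite ltr_norml; lra.
have fp : 0 < f (arm p) (height p) by rewrite f_gt0 // p0 height_le.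
have Hh : height (leg_map p) = f (arm p) (height p).
  by rewrite height_pt // (ltW fp) f_le // (ltW p0) height_le.
have Ha : arm (leg_map p) = b (arm p) by rewrite arm_pt.
have h1p : `|f c r - f c (height p)| < e / 2 by apply: h1; rewrite distrC.
rewrite /close Hh Ha; case: ap => [->|[i]]; first by split; [rewrite distrC; lra | left].
rewrite !lt_min => /and3P[_ _ /h2[j [bj je fj]]] ap; split.
  have := fj (height p); rewrite -ap (ltW p0) height_le => /(_ isT).
  by move: h1p; rewrite !ltr_norml; lra.
by right; exists j; [lra | rewrite ap].
Qed.

Lemma leg_map_inj : injective leg_map.
Proof.
have h0 p : leg_map p = top -> p = top.
  move=> e; apply: contrapT => /height_gt0 p0.
  have fp : 0 < f (arm p) (height p) by rewrite f_gt0 // p0 height_le.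
  move: e => /(congr1 (@height R P)); rewrite height_pt ?height_top; first lra.
  by rewrite (ltW fp) f_le // (ltW p0) height_le.
move=> p q pq; have [pt0|pt0] := pselect (p = top).
  by rewrite pt0; apply/esym/h0; rewrite -pq pt0 /leg_map f_0 pt_le0.
have [qt0|qt0] := pselect (q = top).
  by rewrite qt0; apply: h0; rewrite pq qt0 /leg_map f_0 pt_le0.
move: pt0 qt0 => /height_gt0 p0 /height_gt0 q0.
have fp : 0 < f (arm p) (height p) by rewrite f_gt0 // p0 height_le.
have fq : 0 < f (arm q) (height q) by rewrite f_gt0 // q0 height_le.
have a : arm p = arm q.
  by apply: (can_inj bK); move: pq => /(congr1 (@arm R P)); rewrite !arm_pt.
have hp : height p <= len (arm q) by rewrite -a height_le.
apply: fan_eq => //; move: pq => /(congr1 (@height R P)); rewrite /leg_map a !height_pt.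
- move=> fpq; have [pq|qp|//] := ltgtP (height p) (height q).
    by have := f_mono (ltW p0) pq (height_le q); lra.
  by have := f_mono (ltW q0) qp hp; lra.
- by rewrite (ltW fq) f_le // (ltW q0) height_le.
- by rewrite -{1}a (ltW fp) f_le // (ltW p0) hp.
Qed.

Lemma leg_map_surj y : exists p, leg_map p = y.
Proof.
have [->|/height_gt0 y0] := pselect (y = top).
  by exists top; rewrite /leg_map f_0 pt_le0.
pose c := b' (arm y); have bc : b c = arm y by exact: b'K.
have l0 : 0 <= len c by rewrite ltW ?len_gt0.
have [||z] := @IVT R (f c) 0 (len c) (height y) l0.
- exact/continuous_subspaceT/f_continuous.
- have l1 : 0 <= len (arm y) by rewrite ltW ?len_gt0.
  by rewrite f_0 f_len bc (min_idPl l1) (max_idPr l1) height_ge0 height_le.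
rewrite in_itv /= => zc fz; exists (pt c z).
by rewrite leg_map_pt // fz bc ptK.
Qed.

Lemma leg_map_homeo : homeomorphism leg_map.
Proof.
apply: homeo_of_compact; [exact: fan_hausdorff | exact: fan_compact |..].
- exact: leg_map_continuous.
- exact: leg_map_inj.
- exact: leg_map_surj.
Qed.

End BuildHomeo.

(** * Exchanging a leg with one of its children *)

Section Kink.
Context {R : realType}.
Implicit Types (a b u v r : R).

(** Piecewise linear, through the origin, [(a, a')] and [(b, b')]. *)
Definition kink a b a' b' r :=
  Num.min r a * (a' / a) + Num.max (r - a) 0 * ((b' - a') / (b - a)).

Lemma min_continuous (f g : R -> R) : continuous f -> continuous g ->
  continuous (fun x => Num.min (f x) (g x)).
Proof. by move=> cf cg x; apply: (@continuous_min R R f g x); [exact: cf | exact: cg]. Qed.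

Lemma max_continuous (f g : R -> R) : continuous f -> continuous g ->
  continuous (fun x => Num.max (f x) (g x)).
Proof. by move=> cf cg x; apply: (@continuous_max R R f g x); [exact: cf | exact: cg]. Qed.

Lemma kink_continuous a b a' b' : continuous (kink a b a' b').
Proof.
move=> x; apply: cvgD; apply: cvgMr_tmp.
  by apply: min_continuous => y; [exact: cvg_id | exact: cvg_cst].
apply: (max_continuous (f := fun r => r - a)) => y; last exact: cvg_cst.
by apply: cvgB; [exact: cvg_id | exact: cvg_cst].
Qed.

Lemma kinkE a b a' b' r : r <= a -> kink a b a' b' r = r * (a' / a).
Proof. by move=> ra; rewrite /kink (min_idPl ra) (max_idPr _) ?subr_le0 // mul0r addr0. Qed.

Variables (a b a' b' : R).
Hypotheses (a0 : 0 < a) (ab : a < b) (a'0 : 0 < a') (ab' : a' < b').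

Lemma kinkb : kink a b a' b' b = b'.
Proof.
have ba : b - a != 0 by rewrite subr_eq0 gt_eqF.
rewrite /kink (min_idPr (ltW ab)) (max_idPl _) ?subr_ge0 ?(ltW ab) //.
by field; rewrite ba gt_eqF.
Qed.

Lemma kink_mono u v : u < v -> kink a b a' b' u < kink a b a' b' v.
Proof.
move=> uv; rewrite /kink.
have k0 : 0 < a' / a by rewrite divr_gt0.
have l0 : 0 < (b' - a') / (b - a) by rewrite divr_gt0 // subr_gt0.
case: (leP u a) => ua; case: (leP v a) => va.
- by rewrite !(max_idPr _) ?subr_le0 //; nra.
- by rewrite (max_idPr _) ?subr_le0 // (max_idPl _) ?subr_ge0 ?(ltW va) //; nra.
- by exfalso; lra.
- by rewrite !(max_idPl _) ?subr_ge0 ?(ltW va) ?(ltW ua) //; nra.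
Qed.

Lemma kink_le r : 0 <= r <= b -> kink a b a' b' r <= b' / a * r.
Proof.
move=> /andP[r0 rb]; have [ra|ra] := leP r a.
  rewrite kinkE // mulrC ler_wpM2r // ler_pM2r ?invr_gt0 //; exact: ltW.
have : kink a b a' b' r <= b'.
  by move: rb; rewrite le_eqVlt => /orP[/eqP -> |/kink_mono/ltW]; rewrite kinkb.
move/le_trans; apply; rewrite mulrAC ler_pdivlMr // ler_pM2l ?(ltW ra) //.
exact: lt_trans ab'.
Qed.

End Kink.

Section Swap.
Context {R : realType} (P : fan_spec R).
Notation word := (seq (letter P)).
Implicit Types (s c : word) (k : letter P) (p x y : fan P) (r e : R).
Variables (w : word) (i : letter P).

(* Exchanges the branches [w] and [i :: w], minus the subtree [i :: i :: w]. *)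
Fixpoint swap s : word :=
  if s == w then i :: w else if s == i :: w then w else
  if s == i :: i :: w then s else if s is k :: c then k :: swap c else [::].

Lemma cons_neq k s : (k :: s == s) = false.
Proof. by apply/eqP => /(congr1 size) /=; lia. Qed.

Lemma swap_w : swap w = i :: w.
Proof.
suff h s : s = w -> swap s = i :: w by exact: h.
by case: s => [|k c] /= /eqP ->.
Qed.

Lemma swap_iw : swap (i :: w) = w.
Proof. by rewrite /= cons_neq eqxx. Qed.

Lemma swap_iiw : swap (i :: i :: w) = i :: i :: w.
Proof.
rewrite /=; case: eqP => [/(congr1 size) /=|_]; first lia.
by rewrite eqseq_cons eqxx /= cons_neq !eqxx.
Qed.

Lemma swap_cons k c : k :: c <> w -> k :: c <> i :: w -> k :: c <> i :: i :: w ->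
  swap (k :: c) = k :: swap c.
Proof. by move=> /eqP/negbTE h1 /eqP/negbTE h2 /eqP/negbTE h3; rewrite /= h1 h2 h3. Qed.

Lemma swap_short s : (size s < size w)%N -> swap s = s.
Proof.
elim: s => [|k c IH] h.
  by rewrite /=; case: eqP => // e; move: h; rewrite -e.
rewrite swap_cons ?IH //; first exact: ltnW.
- by move=> e; move: h; rewrite e ltnn.
- by move=> e; move: h; rewrite e /=; lia.
- by move=> e; move: h; rewrite e /=; lia.
Qed.

Lemma swapK : involutive swap.
Proof.
elim=> [|k c IH].
  have [<-|ne] := eqVneq w [::]; first by rewrite swap_w swap_iw.
  by rewrite !(swap_short (s := [::])) // lt0n size_eq0.
have [->|/eqP h1] := eqVneq (k :: c) w; first by rewrite swap_w swap_iw.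
have [->|/eqP h2] := eqVneq (k :: c) (i :: w); first by rewrite swap_iw swap_w.
have [->|/eqP h3] := eqVneq (k :: c) (i :: i :: w); first by rewrite !swap_iiw.
rewrite (swap_cons h1 h2 h3) swap_cons ?IH // => e.
(* Here [k :: swap c = w], so [swap c] is shorter than [w] and therefore fixed. *)
- have cE : swap c = c by rewrite -[RHS]IH (swap_short (s := swap c)) // -[X in (_ < size X)%N]e /=.
  by apply: h1; rewrite -e cE.
- by case: e => kE cE; apply: h3; rewrite kE -(IH) cE swap_w.
- by case: e => kE cE; apply: h2; rewrite kE -(IH) cE swap_iw.
Qed.

End Swap.

Lemma linear_continuous_real (R : realType) (k : R) : continuous (fun r : R => r * k).
Proof. by move=> x; apply: cvgMr_tmp; exact: cvg_id. Qed.

Section SwapHomeo.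
Context {R : realType} (P : fan_spec R).
Notation word := (seq (letter P)).
Implicit Types (s c : word) (k : letter P) (p x y : fan P) (r e u v : R).
Variables (w : word) (i : letter P).
Notation sw := (swap w i).

(** A word other than [w] and [i :: w] is either fixed or keeps its first letter, so its length and
    its ratio change by the same factor. *)
Lemma swapP s : [\/ s = w, s = i :: w | [/\ s <> w, s <> i :: w &
  len s * (ratio (sw s) / ratio s) = len (sw s)]].
Proof.
have [->|/eqP h1] := eqVneq s w; first by constructor 1.
have [->|/eqP h2] := eqVneq s (i :: w); first by constructor 2.
constructor 3; split=> //.
have [->|/eqP h3] := eqVneq s (i :: i :: w).
  by rewrite swap_iiw divff ?mulr1 // gt_eqF // ratio_gt0.
case: s h1 h2 h3 => [|k c] h1 h2 h3.
  rewrite swap_short ?divff ?mulr1 //; last by rewrite lt0n size_eq0; apply/eqP => e; apply: h1.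
  by rewrite /= oner_eq0.
rewrite swap_cons //=; field.
by rewrite !gt_eqF ?ratio_gt0 ?scale_gt0.
Qed.

(** No ratio grows by more than the factor [(scale i)^-1], whatever [s] is; this gives continuity at
    the top. *)
Lemma ratio_swap s : ratio (sw s) * scale i <= ratio s.
Proof.
have s0 := scale_gt0 i; have sl := scale_le i.
have hw : ratio (sw w) * scale i <= ratio w.
  have ss : scale i * scale i <= 1 by nra.
  by rewrite swap_w /= mulrAC ler_piMl // ltW ?ratio_gt0.
elim: s => [|k c IH].
  have [->//|h1] := eqVneq [::] w.
  have h0 : (size (Nil (letter P)) < size w)%N by rewrite lt0n size_eq0 eq_sym.
  by rewrite (swap_short _ h0) /=; lra.
have [->//|/eqP h1] := eqVneq (k :: c) w.
have [->|/eqP h2] := eqVneq (k :: c) (i :: w); first by rewrite swap_iw /= mulrC.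
have [->|/eqP h3] := eqVneq (k :: c) (i :: i :: w).
  rewrite swap_iiw; have := ratio_gt0 (i :: i :: w); nra.
by rewrite swap_cons //= -mulrA ler_pM2l // scale_gt0.
Qed.

(** The kink sits at [ratio s * cut], which no child of [s] exceeds: at the heights reached by
    children, the map of leg [s] has the slope that all but finitely many of them have. *)
Definition swap_leg s r : R :=
  if (s == w) || (s == i :: w)
  then kink (ratio s * cut P) (len s) (ratio (sw s) * cut P) (len (sw s)) r
  else r * (ratio (sw s) / ratio s).

Lemma swap_legE s r : r <= ratio s * cut P -> swap_leg s r = r * (ratio (sw s) / ratio s).
Proof.
move=> h; rewrite /swap_leg; case: ifP => // _; rewrite kinkE //; congr (_ * _).
by field; rewrite !gt_eqF ?ratio_gt0 ?cut_gt0.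
Qed.

Lemma swap_leg_small s r : 0 <= r <= len s ->
  swap_leg s r <= Num.max (scale i)^-1 (Num.max (len (i :: w) / (ratio w * cut P))
    (len w / (ratio (i :: w) * cut P))) * r.
Proof.
move=> /andP[r0 rs]; rewrite /swap_leg; set M := Num.max _ _.
have c0 := ratio_cut_gt0; have cl := ratio_cut_len.
case: eqVneq => [e|_] /=.
  apply: le_trans (kink_le _ _ _ _ _) _ => //; rewrite ?r0 //.
  by apply: ler_wpM2r => //; rewrite e swap_w /M !le_max lexx !orbT.
case: eqVneq => [e|_] /=.
  apply: le_trans (kink_le _ _ _ _ _) _ => //; rewrite ?r0 //.
  by apply: ler_wpM2r => //; rewrite e swap_iw /M !le_max lexx !orbT.
rewrite mulrC; apply: ler_wpM2r => //.
rewrite /M le_max; apply/orP; left.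
rewrite ler_pdivrMr ?ratio_gt0 // mulrC ler_pdivlMr ?scale_gt0 //; exact: ratio_swap.
Qed.

Definition swap_map := leg_map sw swap_leg.

Lemma swap_leg_0 s : swap_leg s 0 = 0.
Proof. by rewrite swap_legE ?mul0r // ltW ?ratio_cut_gt0. Qed.

Lemma swap_leg_len s : swap_leg s (len s) = len (sw s).
Proof.
rewrite /swap_leg; case: (swapP s) => [->|->|[/eqP/negbTE -> /eqP/negbTE -> //]].
  by rewrite eqxx kinkb ?ratio_cut_gt0 ?ratio_cut_len.
by rewrite eqxx orbT kinkb ?ratio_cut_gt0 ?ratio_cut_len.
Qed.

Lemma swap_leg_mono s u v : 0 <= u -> u < v -> v <= len s -> swap_leg s u < swap_leg s v.
Proof.
move=> _ uv _; rewrite /swap_leg; case: ifP => _.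
  by apply: kink_mono; rewrite ?ratio_cut_gt0 ?ratio_cut_len.
by rewrite ltr_pM2r // divr_gt0 ?ratio_gt0.
Qed.

Lemma swap_map_homeo : homeomorphism swap_map.
Proof.
apply: (leg_map_homeo (b' := sw)).
- exact: swapK.
- exact: swapK.
- move=> s; rewrite /swap_leg; case: ((s == w) || (s == i :: w)).
    exact: kink_continuous.
  exact: linear_continuous_real.
- exact: swap_leg_mono.
- exact: swap_leg_0.
- exact: swap_leg_len.
(* A letter of scale below [weight w] and [scale i] cannot be the first letter of an exceptional
   word [w], [i :: w] or [i :: i :: w]. *)
- move=> c e e0; exists (Num.min e (Num.min (weight w) (scale i))).
    by rewrite !lt_min e0 weight_gt0 scale_gt0.
  move=> k; rewrite !lt_min => /and3P[ke kw ki].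
  have n1 : k :: c <> w by move=> h; move: kw; rewrite -h ltxx.
  have n2 : k :: c <> i :: w by case=> h; move: ki; rewrite h ltxx.
  have n3 : k :: c <> i :: i :: w by case=> h; move: ki; rewrite h ltxx.
  exists k; split=> //; first exact: swap_cons.
  move=> r /andP[r0 rk]; have rc := le_trans rk (len_cons k c).
  rewrite (swap_legE rc) /swap_leg; move/eqP/negbTE: (n1) => ->; move/eqP/negbTE: (n2) => ->.
  rewrite orbb swap_cons //= (_ : _ - _ = 0) ?normr0 //.
  by field; rewrite !gt_eqF ?ratio_gt0 ?scale_gt0.
- move=> e e0; set M := Num.max (scale i)^-1 (Num.max (len (i :: w) / (ratio w * cut P))
    (len w / (ratio (i :: w) * cut P))).
  have M0 : 0 < M by rewrite lt_max invr_gt0 scale_gt0.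
  exists (e / M); first by rewrite divr_gt0.
  move=> s r rs; rewrite ltr_pdivlMr // mulrC; apply: le_lt_trans; exact: swap_leg_small.
Qed.

Lemma swap_map_leg r : 0 < r <= len (i :: w) ->
  exists2 r', 0 < r' <= len w /\ (r = len (i :: w) -> r' = len w) &
  same_orbit (pt (i :: w) r) (pt w r').
Proof.
move=> /andP[r0 rl]; exists (swap_leg (i :: w) r); last first.
  exists swap_map; split; first exact: swap_map_homeo.
  rewrite /swap_map leg_map_pt ?swap_iw ?(ltW r0) //; exact: swap_leg_0.
split; last by move=> ->; rewrite swap_leg_len swap_iw.
apply/andP; split; first by rewrite -(swap_leg_0 (i :: w)); exact: swap_leg_mono.
have <- : swap_leg (i :: w) (len (i :: w)) = len w by rewrite swap_leg_len swap_iw.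
move: rl; rewrite le_eqVlt => /orP[/eqP -> //|rl].
by apply/ltW/swap_leg_mono => //; exact: ltW.
Qed.

End SwapHomeo.

Lemma same_orbit_root (R : realType) (P : fan_spec R) (c : seq (letter P)) (r : R) :
  0 < r <= len c ->
  exists2 r', 0 < r' <= 1 /\ (r = len c -> r' = 1) & same_orbit (pt c r) (pt [::] r').
Proof.
elim: c r => [|i w IH] r h.
  by exists r; [split | exact: same_orbit_refl].
have [r1 [h1 e1] o1] := swap_map_leg h; have [r2 [h2 e2] o2] := IH _ h1.
by exists r2; [split=> // /e1 | exact: same_orbit_trans o2].
Qed.

Lemma fan_endpoint_homogeneous (R : realType) (P : fan_spec R) :
  letter P -> endpoint_homogeneous (fan P).
Proof.
move=> i0; have h (e : fan P) : endpoint e -> same_orbit e (tip_pt [::]).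
  move=> /(endpoint_tip i0)[c ->]; have cc : 0 < len (P := P) c <= len c by rewrite len_gt0 lexx.
  by have [r' [_ /(_ erefl) ->]] := same_orbit_root cc.
by move=> e e' /h he /h he'; exact: same_orbit_trans (same_orbit_sym he').
Qed.

(** * Extending a homeomorphism of the root leg to the fan *)

Section RootLegHomeo.
Context {R : realType} (P : fan_spec R).
Notation word := (seq (letter P)).
Implicit Types (s c : word) (i j : letter P) (r e u v : R).
Variables (g g' : letter P -> letter P) (phi : R -> R) (M : R).
Hypothesis gK : cancel g g'.
Hypothesis g'K : cancel g' g.
(** Keeps letters of small scale small and bounds the stretching of the legs near the top. *)
Hypothesis scale_g : forall i, scale (g i) <= M * scale i.
Hypothesis phi_continuous : continuous phi.
Hypothesis phi_mono : forall u v, 0 <= u -> u < v -> v <= 1 -> phi u < phi v.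
Hypothesis phi0 : phi 0 = 0.
Hypothesis phi1 : phi 1 = 1.
Hypothesis phi_tip : forall i, phi (tip i) = tip (g i).

(** Only the last letter of the word, the one next to the root, is changed: the legs [[:: i]] must
    follow [phi], and the legs attached to them are carried along. *)
Fixpoint relabel (f : letter P -> letter P) s : word :=
  if s is i :: c then (if c is [::] then [:: f i] else i :: relabel f c) else [::].

Lemma relabel_cons f i c : c <> [::] -> relabel f (i :: c) = i :: relabel f c.
Proof. by case: c. Qed.

Lemma relabel_nil f c : relabel f c = [::] -> c = [::].
Proof. by case: c => [|i [|j c]]. Qed.

Lemma relabelK f f' : cancel f f' -> cancel (relabel f) (relabel f').
Proof.
move=> fK; elim=> [//|i c IH]; have [->|c0] := pselect (c = [::]); first by rewrite /= fK.
by rewrite relabel_cons // relabel_cons ?IH // => /relabel_nil.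
Qed.

(** On leg [[:: i]] the map must be linear up to [scale i * cut], to fit the legs attached there,
    and close to [phi] when [scale i] is small, to fit the root leg. Beyond the linear part, [phi]
    is rescaled affinely so that tips still match. *)
Definition bend i r : R :=
  let a := scale i * cut P in let a' := scale (g i) * cut P in
  Num.min r a * (a' / a) +
  (phi (Num.max r a) - phi a) * ((tip (g i) - a') / (tip (g i) - phi a)).

Definition relabel_leg s : R -> R :=
  match s with
  | [::] => phi
  | [:: i] => bend i
  | _ => fun r => r * (ratio (relabel g s) / ratio s)
  end.

Lemma tip_le1 i : tip i <= 1.
Proof. exact: le_trans (tip_le i) (ltW (cut_lt1 P)). Qed.

Lemma scale_cut_gt0 i : 0 < scale i * cut P.
Proof. by rewrite mulr_gt0 ?scale_gt0 ?cut_gt0. Qed.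

Lemma phi_scale_lt i : phi (scale i * cut P) < tip (g i).
Proof.
rewrite -phi_tip; apply: phi_mono; rewrite ?tip_le1 ?scale_cut //.
by rewrite ltW // scale_cut_gt0.
Qed.

Lemma bendE i r : r <= scale i * cut P -> bend i r = r * (scale (g i) / scale i).
Proof.
move=> h; rewrite /bend (min_idPl h) (max_idPr h) subrr mul0r addr0; congr (_ * _).
by field; rewrite !gt_eqF ?scale_gt0 ?cut_gt0.
Qed.

Lemma bend_gtE i r : scale i * cut P <= r -> bend i r = scale (g i) * cut P +
  (phi r - phi (scale i * cut P)) *
  ((tip (g i) - scale (g i) * cut P) / (tip (g i) - phi (scale i * cut P))).
Proof.
move=> h; rewrite /bend (min_idPr h) (max_idPl h); congr (_ + _).
by field; rewrite !gt_eqF ?scale_gt0 ?cut_gt0.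
Qed.

Lemma bend_slope_gt0 i :
  0 < (tip (g i) - scale (g i) * cut P) / (tip (g i) - phi (scale i * cut P)).
Proof. by rewrite divr_gt0 ?subr_gt0 ?scale_cut ?phi_scale_lt. Qed.

Lemma bend_mono i u v : 0 <= u -> u < v -> v <= tip i -> bend i u < bend i v.
Proof.
move=> u0 uv vi; have v1 := le_trans vi (tip_le1 i).
have k0 : 0 < scale (g i) / scale i by rewrite divr_gt0 ?scale_gt0.
have l0 := bend_slope_gt0 i.
have lin w z : w < z -> w * (scale (g i) / scale i) < z * (scale (g i) / scale i).
  by move=> wz; rewrite ltr_pM2r.
have cur w z : scale i * cut P <= w -> w < z -> z <= 1 -> bend i w < bend i z.
  move=> aw wz z1; rewrite !bend_gtE ?(le_trans aw (ltW wz)) // ltrD2l ltr_pM2r // ltrD2r.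
  by apply: phi_mono => //; exact: le_trans (ltW (scale_cut_gt0 i)) aw.
have [va|av] := leP v (scale i * cut P).
  by rewrite !bendE ?(le_trans (ltW uv)) //; exact: lin.
have [au|ua] := leP (scale i * cut P) u; first exact: cur.
apply: lt_trans (cur _ _ (lexx _) av v1); rewrite !bendE ?(ltW ua) //; exact: lin.
Qed.

Lemma bend_continuous i : continuous (bend i).
Proof.
have c1 : continuous (fun r => Num.min r (scale i * cut P)).
  by apply: min_continuous => y; [exact: cvg_id | exact: cvg_cst].
have c2 : continuous (fun r => Num.max r (scale i * cut P)).
  by apply: max_continuous => y; [exact: cvg_id | exact: cvg_cst].
move=> x; apply: cvgD; apply: cvgMr_tmp; first exact: c1.
apply: cvgB; last exact: cvg_cst.
by apply: continuous_comp; [exact: c2 | exact: phi_continuous].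
Qed.

Lemma bend_tip i : bend i (tip i) = tip (g i).
Proof.
rewrite bend_gtE ?phi_tip; last exact/ltW/scale_cut.
have d0 : tip (g i) - phi (scale i * cut P) != 0 by rewrite subr_eq0 gt_eqF ?phi_scale_lt.
by rewrite mulrCA divff // mulr1 addrC subrK.
Qed.

Lemma phi_ge0 r : 0 <= r <= 1 -> 0 <= phi r.
Proof.
move=> /andP[]; rewrite le_eqVlt => /orP[/eqP <- _|r0 r1]; first by rewrite phi0.
by rewrite -phi0 ltW // phi_mono.
Qed.

Lemma phi_le u v : 0 <= u -> u <= v -> v <= 1 -> phi u <= phi v.
Proof.
move=> u0; rewrite le_eqVlt => /orP[/eqP -> //|uv v1].
by rewrite ltW // phi_mono.
Qed.

(* Both functions agree at [tip i], and past [scale i * cut P] their difference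
   is an affine function of [phi r]. *)
Lemma bend_near i r : 0 <= r <= tip i ->
  `|bend i r - phi r| <= Num.max (scale (g i) * cut P) (phi (scale i * cut P)).
Proof.
move=> /andP[r0 ri]; have r1 := le_trans ri (tip_le1 i).
set a := scale i * cut P; set a' := scale (g i) * cut P.
have a0 : 0 < a := scale_cut_gt0 i; have a'0 : 0 < a' := scale_cut_gt0 (g i).
have a1 : a <= 1 by rewrite (le_trans (ltW (scale_cut i))) ?tip_le1.
set m := Num.max a' (phi a).
have m1 : a' <= m by rewrite le_max lexx.
have m2 : phi a <= m by rewrite le_max lexx orbT.
have [ra|ar] := leP r a.
  have pr : 0 <= phi r by rewrite phi_ge0 ?r0.
  have pa : phi r <= phi a by apply: phi_le.
  have b0 : 0 <= bend i r by rewrite bendE // mulr_ge0 // divr_ge0 // ltW ?scale_gt0.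
  have ba : bend i r <= a'.
    rewrite bendE // /a' mulrCA ler_pM2l ?scale_gt0 // ler_pdivrMr ?scale_gt0 //.
    by rewrite mulrC.
  by rewrite ler_norml; apply/andP; split; lra.
have pa : phi a <= phi r by apply: phi_le => //; exact: ltW.
have pb : phi r <= tip (g i) by rewrite -phi_tip phi_le // tip_le1.
have ab : phi a < tip (g i) := phi_scale_lt i.
have -> : bend i r - phi r = (a' - phi a) * ((tip (g i) - phi r) / (tip (g i) - phi a)).
  by rewrite bend_gtE ?ltW // -/a -/a'; field; rewrite subr_eq0 gt_eqF.
rewrite normrM; apply: le_trans (_ : _ <= `|a' - phi a| * 1) _.
  apply: ler_wpM2l => //; rewrite ger0_norm; last by rewrite divr_ge0 // subr_ge0 // ltW.
  by rewrite ler_pdivrMr ?subr_gt0 // mul1r; lra.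
have p0 : 0 <= phi a by apply: phi_ge0; rewrite a1 ltW.
by rewrite mulr1 ler_norml; apply/andP; split; lra.
Qed.

Lemma ratio_relabel s : 1 <= M -> ratio (relabel g s) <= M * ratio s.
Proof.
move=> M1; elim: s => [|i [|j c] IH]; first by rewrite /= mulr1.
  by rewrite /= !mulr1.
rewrite [ratio (i :: _)]/= [relabel _ _]/= [ratio (i :: _)]/= mulrCA.
by rewrite ler_pM2l ?scale_gt0.
Qed.

Lemma relabel_leg_cons i c : c <> [::] ->
  relabel_leg (i :: c) = (fun r => r * (ratio (relabel g c) / ratio c)).
Proof.
move=> c0; rewrite (_ : _ / _ = ratio (relabel g (i :: c)) / ratio (i :: c)).
  by case: c c0.
by rewrite relabel_cons //=; field; rewrite !gt_eqF ?ratio_gt0 ?scale_gt0.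
Qed.

Lemma phi_near0 e : 0 < e -> exists2 d, 0 < d & forall r, 0 <= r -> r < d -> phi r < e.
Proof.
move=> e0; have /cvgrPdist_lt/(_ _ e0)/nbhs_ballP[d /= d0 dh] : phi z @[z --> (0 : R)] --> phi 0.
  exact: phi_continuous.
exists d => // r r0 rd; have /dh : ball (0 : R) d r.
  by rewrite /ball /= sub0r normrN ger0_norm.
by rewrite phi0 sub0r normrN /=; apply: le_lt_trans; exact: ler_norm.
Qed.

Lemma relabel_leg0 s : relabel_leg s 0 = 0.
Proof.
case: s => [|i c] //; have [->|c0] := pselect (c = [::]).
  by rewrite /= bendE ?mul0r // ltW // scale_cut_gt0.
by rewrite relabel_leg_cons // mul0r.
Qed.

Lemma root_leg_homeo_subproof : 1 <= M -> homeomorphism (leg_map (relabel g) relabel_leg).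
Proof.
move=> M1; have M0 : 0 < M by lra.
apply: (leg_map_homeo (b' := relabel g')).
- exact: relabelK.
- exact: relabelK.
- case=> [|i c] //; have [->|c0] := pselect (c = [::]); first exact: bend_continuous.
  by rewrite relabel_leg_cons //; exact: linear_continuous_real.
- case=> [|i c] u v u0 uv; first exact: phi_mono.
  have [->|c0] := pselect (c = [::]); first by rewrite /= mulr1; exact: bend_mono.
  by rewrite relabel_leg_cons // => _; rewrite ltr_pM2r // divr_gt0 // ratio_gt0.
- exact: relabel_leg0.
- case=> [|i c] //; have [->|c0] := pselect (c = [::]); first by rewrite /= !mulr1 bend_tip.
  rewrite relabel_leg_cons // relabel_cons //=.
  by field; rewrite gt_eqF ?ratio_gt0.
- case=> [|i c] e e0.
    have [d d0 dh] := phi_near0 e0.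
    exists (Num.min (e / M) d); first by rewrite lt_min divr_gt0.
    move=> i; rewrite lt_min ltr_pdivlMr // mulrC => /andP[ie id'].
    have ge' : scale (g i) < e by exact: le_lt_trans (scale_g i) ie.
    exists (g i); split=> //; move=> r; rewrite /= mulr1 => ri.
    apply: le_lt_trans (bend_near ri) _; rewrite gt_max; apply/andP; split.
      by apply: lt_trans ge'; rewrite -[X in _ < X]mulr1 ltr_pM2l ?scale_gt0 ?cut_lt1.
    apply: dh; first by rewrite ltW ?scale_cut_gt0.
    by apply: lt_trans id'; rewrite -[X in _ < X]mulr1 ltr_pM2l ?scale_gt0 ?cut_lt1.
  (* Below [ratio (i :: c) * cut] leg [i :: c] is mapped linearly, by the same factor as its
     children, so the two maps agree exactly. *)
  exists e => // k ke; exists k; split=> // r rl.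
  have rk : r <= ratio (i :: c) * cut P.
    by case/andP: rl => _ /le_trans; apply; exact: len_cons.
  suff -> : relabel_leg (k :: i :: c) r = relabel_leg (i :: c) r by rewrite subrr normr0.
  rewrite relabel_leg_cons //; have [c0|c0] := pselect (c = [::]).
    rewrite c0 /= mulr1 in rk *.
    by rewrite bendE // !mulr1.
  rewrite relabel_leg_cons // relabel_cons //=; congr (_ * _).
  by field; rewrite !gt_eqF ?scale_gt0 ?ratio_gt0.
- move=> e e0; have e20 : 0 < e / 2 by lra.
  have [d d0 dh] := phi_near0 e20.
  exists (Num.min d (e / 2 / M)); first by rewrite lt_min d0 divr_gt0.
  move=> s r /andP[r0 rs]; rewrite lt_min ltr_pdivlMr // => /andP[rd rM].
  have hr := dh r r0 rd.
  case: s rs => [|i c] rs; first by rewrite /=; lra.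
  have [c0|c0] := pselect (c = [::]); last first.
    rewrite relabel_leg_cons //; apply: le_lt_trans (_ : _ <= r * M) _; last by lra.
    by rewrite ler_wpM2l // ler_pdivrMr ?ratio_gt0 // ratio_relabel.
  rewrite c0 /= mulr1 in rs *; have ri : 0 <= r <= tip i by rewrite r0.
  have [ra|ar] := leP r (scale i * cut P).
    rewrite bendE //; apply: le_lt_trans (_ : _ <= r * M) _; last by lra.
    by rewrite ler_wpM2l // ler_pdivrMr ?scale_gt0.
  have := bend_near ri; rewrite ler_norml => /andP[_].
  have pa : phi (scale i * cut P) <= phi r.
    apply: phi_le; [exact/ltW/scale_cut_gt0 | exact: ltW |].
    exact: le_trans rs (tip_le1 i).
  have ga : scale (g i) * cut P <= r * M.
    have := scale_g i; have := cut_gt0 P; have := scale_gt0 i; nra.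
  set m := Num.max _ _ => hm; suff : m < e / 2 by lra.
  by rewrite gt_max; apply/andP; split; lra.
Qed.

Lemma root_leg_homeo r : 1 <= M -> 0 <= r <= 1 ->
  same_orbit (pt (P := P) [::] r) (pt [::] (phi r)).
Proof.
move=> M1 r01; exists (leg_map (relabel g) relabel_leg); split.
  exact: root_leg_homeo_subproof.
by rewrite leg_map_pt //; exact: relabel_leg0.
Qed.

End RootLegHomeo.

(** * Orbits of points of a leg *)

Section RootLegOrbits.
Context {R : realType} (P : fan_spec R).
Notation word := (seq (letter P)).
Implicit Types (c : word) (i j : letter P) (p x y : fan P) (r s e u v : R).

Definition tip_height s := exists i : letter P, tip i = s.

(** Makes every tip height a limit of endpoints; the hypothesis [tip_or_gap] ensures that no other
    inner point of the root leg is one. *)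
Hypothesis tip_rep : forall i e, 0 < e -> exists2 j : letter P, tip j = tip i & scale j < e.
Hypothesis tip_or_gap : forall r, 0 < r -> r < 1 -> tip_height r \/
  exists u v, [/\ 0 <= u, u < r, r < v, v <= 1 &
    forall i : letter P, tip i <= u \/ v <= tip i].

Definition special p := [/\ p <> top, two_pronged p & closure [set x | ~ two_pronged x] p].

Lemma homeo_top (h : fan P -> fan P) : letter P -> homeomorphism h -> h top = top.
Proof.
by move=> i0 hh; apply/three_pronged_top/(homeo_three_pronged hh)/top_three_pronged.
Qed.

Lemma homeo_special (h : fan P -> fan P) p :
  letter P -> homeomorphism h -> special p -> special (h p).
Proof.
move=> i0 hh [p0 pp cp]; split.
- by rewrite -(homeo_top i0 hh) => /(homeo_inj hh).
- exact: homeo_two_pronged.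
apply: (homeo_closure hh) cp => y /= ny; apply: contra_not ny => hy.
have [k [hk kh _]] := homeo_inv hh.
by rewrite -[y]kh; exact: homeo_two_pronged.
Qed.

(** An endpoint close to a point in a gap would be the tip of the root leg or of a leg [[:: i]], and
    these have heights outside the gap. *)
Lemma special_root (i0 : letter P) r : 0 < r -> r < 1 -> special (pt [::] r) <-> tip_height r.
Proof.
move=> r0 r1; have rl : 0 < r <= len (P := P) [::] by rewrite r0 ltW.
have rl' : 0 <= r <= len (P := P) [::] by rewrite !ltW.
split=> [[_ _ cl]|[i ir]].
  have [//|[u [v [u0 ur rv v1 uv]]]] := tip_or_gap r0 r1; exfalso.
  pose e := Num.min (r - u) (v - r).
  have e0 : 0 < e by rewrite lt_min !subr_gt0 ur.
  have : nbhs (pt [::] r) (close (P := P) [::] r e) by apply/(nbhs_ptP _ rl); exists e.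
  move=> /cl[x [/= xt [hx ax]]].
  have [c xc] : exists c, x = tip_pt c.
    apply: contrapT => nx; apply/xt/(two_prongedE i0) => c xc; apply: nx; by exists c.
  have hc : height x = len c by rewrite xc height_pt // lexx ltW ?len_gt0.
  have ac : arm x = c by rewrite xc arm_pt ?len_gt0.
  move: hx; rewrite hc lt_min !ltr_norml; case: ax => [|[i ie]]; rewrite ac => -> /=.
    lra.
  by rewrite mulr1; have := uv i; lra.
have h : height (pt (P := P) [::] r) = r by rewrite height_pt.
split.
- by apply/height_gt0; rewrite h.
- apply/(two_prongedE i0) => c e; have : arm (tip_pt c) = [::] by rewrite -e arm_pt.
  rewrite arm_pt ?len_gt0 // => c0; move: h; rewrite e c0 height_pt /=; first lra.
  by rewrite ler01 lexx.
move=> U /(nbhs_ptP _ rl)[e e0 eU]; have [j ji je] := tip_rep i e0.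
exists (tip_pt [:: j]); split; first exact: tip_not_two_pronged.
apply: eU; split; last by right; exists j; rewrite // arm_pt ?len_gt0.
by rewrite height_pt ?lexx ?ltW ?len_gt0 //= mulr1 ji ir subrr normr0.
Qed.

(** The leg below [y] is itself closed and connected, and every closed connected set through the top
    and [y] contains it; so [beyond] is the order along the leg. *)
Lemma beyond_root r y : 0 < r -> r <= 1 ->
  beyond top (pt [::] r) y <-> arm y = [::] /\ r <= height y.
Proof.
move=> r0 r1; split=> [h|[ay ry] A clA cA At Ay]; last first.
  by rewrite -ay; apply: closed_connected_leg => //; rewrite ltW.
have cl : closed (legpart (arm y) 0 (height y)) by exact: legpart_closed.
have cn : connected (legpart (arm y) 0 (height y)) by exact: legpart_connected.
have [||z] := h _ cl cn.
- by exists 0; rewrite ?pt_le0 //= in_itv /= lexx height_ge0.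
- by exists (height y); rewrite ?ptK //= in_itv /= lexx height_ge0.
rewrite /= in_itv /= => /andP[z0 zy] e.
have zr : z = r.
  have hz : 0 <= z <= len (arm y) by rewrite z0 (le_trans zy) ?height_le.
  have hr : 0 <= r <= len (P := P) [::] by rewrite ltW.
  by move: e => /(congr1 (@height R P)); rewrite (height_pt hz) (height_pt hr).
split; last by rewrite -zr.
by move: e => /(congr1 (@arm R P)); rewrite zr !arm_pt.
Qed.

(** A homeomorphism fixes the top, so what lies beyond [r] lands beyond [r'], in particular on the
    root leg again. The function [f] is the height of the image. *)
Lemma same_orbit_root_tips (i0 : letter P) r r' : 0 < r -> r <= 1 -> 0 < r' -> r' < 1 ->
  same_orbit (pt (P := P) [::] r) (pt [::] r') ->
  exists f : R -> R, (forall s, tip_height s -> r <= s -> tip_height (f s) /\ r' <= f s) /\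
    (forall s t, tip_height s -> tip_height t -> r <= s -> r <= t -> f s = f t -> s = t).
Proof.
move=> r0 r1 r'0 r'1 [h [hh hr]].
have tip01 s : tip_height s -> 0 < s /\ s < 1.
  by move=> [i <-]; split; [exact: tip_gt0 | exact: le_lt_trans (tip_le i) (cut_lt1 P)].
pose H s := h (pt [::] s).
have key s : tip_height s -> r <= s ->
    [/\ arm (H s) = [::], r' <= height (H s) & tip_height (height (H s))].
  move=> ts rs; have [s0 s1] := tip01 _ ts.
  have : beyond top (pt (P := P) [::] r) (pt [::] s).
    by apply/beyond_root => //; rewrite arm_pt // height_pt // !ltW.
  move=> /(homeo_beyond hh); rewrite (homeo_top i0 hh) hr => /beyond_root[] //.
    exact: ltW.
  move=> aH rH; have sH : special (H s) by apply: homeo_special => //; exact/special_root.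
  split=> //; apply/special_root => //; first exact: lt_le_trans rH.
    rewrite lt_neqAle; apply/andP; split; last exact: height_le1.
    apply/eqP => h1; have [_ /(two_prongedE i0) /(_ [::]) nt _] := sH; apply: nt.
    by rewrite /tip_pt -{1}(ptK (H s)) aH h1.
  by rewrite -aH ptK.
exists (fun s => height (H s)); split=> [s ts rs|s t ts tt rs rt e].
  by have [] := key s ts rs.
have [as_ _ _] := key s ts rs; have [at_ _ _] := key t tt rt.
have /(homeo_inj hh) : H s = H t by apply: fan_eq; rewrite ?as_.
have [[? ?] [? ?]] := (tip01 _ ts, tip01 _ tt).
by apply: pt_inj; apply/andP; split; exact: ltW.
Qed.

Lemma same_orbit_tip_height (i0 : letter P) r r' : 0 < r -> r < 1 -> 0 < r' -> r' < 1 ->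
  same_orbit (pt (P := P) [::] r) (pt [::] r') -> tip_height r -> tip_height r'.
Proof.
move=> r0 r1 r'0 r'1 [h [hh hr]] /(special_root i0 r0 r1) /(homeo_special i0 hh).
by rewrite hr => /special_root; exact.
Qed.

(** Compares the numbers of tip heights at or above [r] and [r']. [L] need not list all those above
    [r], which may be infinitely many. *)
Lemma same_orbit_count (i0 : letter P) r r' (L L' : seq R) :
  0 < r -> r <= 1 -> 0 < r' -> r' < 1 ->
  same_orbit (pt (P := P) [::] r) (pt [::] r') ->
  uniq L -> (forall s, s \in L -> tip_height s /\ r <= s) ->
  (forall s, tip_height s -> r' <= s -> s \in L') -> (size L <= size L')%N.
Proof.
move=> r0 r1 r'0 r'1 o uL hL hL'.
have [f [fP fI]] := same_orbit_root_tips i0 r0 r1 r'0 r'1 o.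
rewrite -(size_map f); apply: uniq_leq_size.
  rewrite map_inj_in_uniq // => s t /hL[ts rs] /hL[tt rt]; exact: fI.
by move=> _ /mapP[s /hL[ts rs] ->]; have [? ?] := fP s ts rs; exact: hL'.
Qed.

Lemma top_neq_pt (i0 : letter P) r : 0 < r -> ~ same_orbit (top : fan P) (pt [::] r).
Proof.
move=> r0 [h [hh]]; rewrite (homeo_top i0 hh) => /(congr1 (@height R P)).
rewrite height_top /height val_pt //= => e.
have : 0 < Num.min r 1 by rewrite lt_min r0 ltr01.
by rewrite -e ltxx.
Qed.

Lemma tip_neq_pt (i0 : letter P) r : 0 < r -> r < 1 ->
  ~ same_orbit (pt (P := P) [::] r) (pt [::] 1).
Proof.
move=> r0 r1 [h [hh e]]; apply: (@tip_not_two_pronged R P [::]).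
rewrite -[tip_pt _]e; apply: (homeo_two_pronged hh); apply/(two_prongedE i0) => c e'.
have c0 : [::] = c by move: e' => /(congr1 (@arm R P)); rewrite !arm_pt ?len_gt0.
move: e' => /(congr1 (@height R P)); rewrite -c0 !height_pt /= ?ler01 ?lexx ?ltW //.
lra.
Qed.

End RootLegOrbits.

(** * Moving a height within a gap *)

Section GapMove.
Context {R : realType}.
Implicit Types (r u v x y : R).

(* Piecewise linear, with graph through [(u, u)], [(r, r')] and [(v, v)]. *)
Definition push u v r r' x :=
  x + (r' - r) * Num.max 0 (Num.min ((x - u) / (r - u)) ((v - x) / (v - r))).

Lemma push_continuous u v r r' : continuous (push u v r r').
Proof.
have c1 : continuous (fun x => (x - u) / (r - u)).
  by move=> x; apply: cvgMr_tmp; apply: cvgB; [exact: cvg_id | exact: cvg_cst].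
have c2 : continuous (fun x => (v - x) / (v - r)).
  by move=> x; apply: cvgMr_tmp; apply: cvgB; [exact: cvg_cst | exact: cvg_id].
have c3 := min_continuous c1 c2.
have c4 : continuous (fun _ : R => 0 : R) by move=> y; exact: cvg_cst.
move=> x; apply: cvgD; first exact: cvg_id.
by apply: cvgMl_tmp; exact: (max_continuous c4 c3).
Qed.

Variables (u v r r' : R).
Hypotheses (ur : u < r) (rv : r < v) (ur' : u < r') (r'v : r' < v).

Lemma push_out x : x <= u \/ v <= x -> push u v r r' x = x.
Proof.
move=> h; rewrite /push (max_idPl _) ?mulr0 ?addr0 // ge_min; case: h => h.
  by rewrite ler_pdivrMr ?subr_gt0 // mul0r subr_le0 h.
by rewrite [X in _ || X]ler_pdivrMr ?subr_gt0 // mul0r subr_le0 h orbT.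
Qed.

Lemma push_mid : push u v r r' r = r'.
Proof.
rewrite /push !divff ?gt_eqF ?subr_gt0 // minxx (max_idPr _) ?ler01 // mulr1.
by rewrite addrC subrK.
Qed.

Lemma push_mono x y : x < y -> push u v r r' x < push u v r r' y.
Proof.
move=> xy; rewrite /push.
have ru : 0 < r - u by rewrite subr_gt0.
have vr : 0 < v - r by rewrite subr_gt0.
set a := (y - x) / (r - u); set b := (y - x) / (v - r).
have a0 : 0 < a by rewrite divr_gt0 // subr_gt0.
have b0 : 0 < b by rewrite divr_gt0 // subr_gt0.
have -> : (y - u) / (r - u) = (x - u) / (r - u) + a.
  by rewrite /a -mulrDl; congr (_ / _); ring.
have -> : (v - x) / (v - r) = (v - y) / (v - r) + b.
  by rewrite /b -mulrDl; congr (_ / _); ring.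
move: ((x - u) / (r - u)) ((v - y) / (v - r)) => A B.
set T := Num.max 0 (Num.min A (B + b)); set T' := Num.max 0 (Num.min (A + a) B).
(* From [x] to [y] the tent function rises by at most [a] and falls by at most [b]. As [r' - r] lies
   strictly between [u - r] and [v - r], the correction never outweighs [y - x]. *)
have [h1 h2] : T - b <= T' /\ T' <= T + a.
  rewrite /T /T'; case: (leP A (B + b)) => ?; case: (leP (A + a) B) => ?.
  - by case: (leP 0 A) => ?; case: (leP 0 (A + a)) => ?; split; lra.
  - by case: (leP 0 A) => ?; case: (leP 0 B) => ?; split; lra.
  - by case: (leP 0 (B + b)) => ?; case: (leP 0 (A + a)) => ?; split; lra.
  - by case: (leP 0 (B + b)) => ?; case: (leP 0 B) => ?; split; lra.
have ea : a * (r - u) = y - x by rewrite /a divfK // gt_eqF.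
have eb : b * (v - r) = y - x by rewrite /b divfK // gt_eqF.
have [rr|rr] := leP r r'.
  have g1 : (r' - r) * T <= (r' - r) * (T' + b) by apply: ler_wpM2l; lra.
  have g2 : (r' - r) * b < (v - r) * b by rewrite ltr_pM2r // ltrD2r.
  by move: g1 g2; rewrite mulrDr (mulrC (v - r)) eb; lra.
have g1 : (r' - r) * (T + a) <= (r' - r) * T' by apply: ler_wnM2l; lra.
have g2 : - (r - u) * a < (r' - r) * a by rewrite ltr_pM2r // opprB ltrD2r.
by move: g1 g2; rewrite mulrDr mulNr (mulrC (r - u)) ea; lra.
Qed.

End GapMove.

Lemma same_orbit_gap (R : realType) (P : fan_spec R) (u v r r' : R) :
  0 <= u -> v <= 1 -> u < r -> r < v -> u < r' -> r' < v ->
  (forall i : letter P, tip i <= u \/ v <= tip i) ->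
  same_orbit (pt (P := P) [::] r) (pt [::] r').
Proof.
move=> u0 v1 ur rv ur' r'v uv.
suff : same_orbit (pt (P := P) [::] r) (pt [::] (push u v r r' r)) by rewrite push_mid.
apply: (@root_leg_homeo _ P id id (push u v r r') 1) => //.
- by move=> i; rewrite mul1r.
- exact: push_continuous.
- by move=> x y _ xy _; exact: push_mono.
- by apply: push_out => //; left.
- by apply: push_out => //; right.
- by move=> i; apply: push_out.
- by apply/andP; split; lra.
Qed.

(** * The fans with a prescribed number of orbits *)

Lemma floor_log2 (R : realType) (z : R) : 0 < z -> exists k : int, 2 ^ k <= z < 2 ^ (k + 1).
Proof.
move=> z0; have two0 : (2 : R) != 0 by rewrite pnatr_eq0.
have pow k : 0 < (2 : R) ^ k by exact: exprz_gt0.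
have [n0 hn0] : exists n, 2^-1 ^+ n < z by exact: half_expn_small.
have [m0 hm0] : exists m, 2^-1 ^+ m < z^-1 by apply: half_expn_small; rewrite invr_gt0.
(* Since [2 ^ (- n0) < z], exponents up to [- n0] can be ignored, and a least natural number [m] can
   be sought. *)
pose Q m := (z < 2 ^ (m%:Z - n0%:Z)).
have exQ : exists m, Q m.
  exists (m0 + n0)%N; rewrite /Q PoszD addrK.
  by move: hm0; rewrite exprVn ltf_pV2 ?posrE // exprn_gt0.
case: (ex_minnP exQ) => m Qm minm; exists (m%:Z - 1 - n0%:Z).
case: m Qm minm => [|m] Qm minm.
  move: Qm; rewrite /Q sub0r -exprnN => h.
  by move: hn0; rewrite exprVn => /lt_trans/(_ h); rewrite ltxx.
have -> : m.+1%:Z - 1 - n0%:Z = m%:Z - n0%:Z by lia.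
have -> : m%:Z - n0%:Z + 1 = m.+1%:Z - n0%:Z by lia.
by rewrite [X in _ && X]Qm andbT leNgt; apply/negP => /minm; rewrite ltnn.
Qed.

Section Spec.
Context {R : realType} (l : nat) (ch : bool).
Hypothesis l_gt0 : (0 < l)%N.
Implicit Types (k : int) (n m : nat) (z : R).

(** The even points from 2 to [2 l] are tips, the odd points represent the gaps, and the extreme
    points 0 and [2 l + 2] are the top and the endpoint of the leg. *)
Definition mesh n : R := n%:R / (l.*2.+2)%:R.

(** Maps the positive half-line increasingly onto the gap below [mesh 2], so that the chain is the
    image of the powers of 2 and its symmetry comes from doubling. *)
Definition chain z : R := mesh 2 * (z / (1 + z)).

Definition alphabet : Type := int * 'I_l.+1 * nat.
HB.instance Definition _ := Choice.on alphabet.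

(* A letter [(k, j, m)] has tip [mesh (2 j)] if [j > 0], and else the [k]-th
   point of a chain that tends to 0 and to [mesh 2] (or [mesh 2] if [ch] is
   [false]); [m] repeats every tip infinitely often. *)
Definition spec_tip (i : alphabet) : R :=
  if i.1.2 == ord0 then (if ch then chain (2 ^ i.1.1) else mesh 2) else mesh (i.1.2).*2.

(** The exponent contains [|k|] because the tips of the chain tend to 0 like [2 ^ k], and scales
    must stay below them; together with [m] it leaves finitely many letters above any bound. The 4
    beats the 2 in [spec_tip_ge]. *)
Definition spec_scale (i : alphabet) : R := mesh 2 / 4 * 2^-1 ^+ (`|i.1.1|%N + i.2).

Lemma mesh_lt n m : (mesh n < mesh m) = (n < m)%N.
Proof. by rewrite ltr_pM2r ?ltr_nat // invr_gt0 ltr0n. Qed.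

Lemma mesh_le n m : (mesh n <= mesh m) = (n <= m)%N.
Proof. by rewrite ler_pM2r ?ler_nat // invr_gt0 ltr0n. Qed.

Lemma mesh0 : mesh 0 = 0. Proof. by rewrite /mesh mul0r. Qed.

Lemma mesh_max : mesh l.*2.+2 = 1. Proof. by rewrite /mesh divff // pnatr_eq0. Qed.

Lemma mesh_gt0 n : (0 < n)%N -> 0 < mesh n.
Proof. by rewrite -mesh0 mesh_lt. Qed.

Lemma mesh2_gt0 : 0 < mesh 2. Proof. exact: mesh_gt0. Qed.

Lemma mesh2_le1 : mesh 2 <= 1. Proof. by rewrite -mesh_max mesh_le. Qed.

Lemma chain_gt0 z : 0 < z -> 0 < chain z.
Proof. by move=> z0; rewrite mulr_gt0 ?mesh2_gt0 // divr_gt0 // addr_gt0. Qed.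

Lemma chain_lt z : 0 < z -> chain z < mesh 2.
Proof.
move=> z0; rewrite -[X in _ < X]mulr1 ltr_pM2l ?mesh2_gt0 //.
by rewrite ltr_pdivrMr; lra.
Qed.

Lemma chain_mono z z' : 0 < z -> 0 < z' -> (chain z < chain z') = (z < z').
Proof.
move=> z0 z'0; rewrite ltr_pM2l ?mesh2_gt0 // ltr_pdivrMr ?addr_gt0 // mulrAC.
rewrite ltr_pdivlMr ?addr_gt0 // !mulrDr !mulr1 [z' * z]mulrC ltrD2r //.
Qed.

Lemma chain_surj r : 0 < r -> r < mesh 2 -> exists2 z, 0 < z & chain z = r.
Proof.
move=> r0 r2; exists (r / (mesh 2 - r)); first by rewrite divr_gt0 ?subr_gt0.
have b0 := mesh2_gt0; rewrite /chain; field.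
by rewrite subr_eq0 gt_eqF //= subrK gt_eqF.
Qed.

Lemma pow2_gt0 k : 0 < (2 : R) ^ k. Proof. exact: exprz_gt0. Qed.

Lemma half_absz_le k : 2^-1 ^+ `|k|%N <= (2 : R) ^ k.
Proof.
case: k => n /=; last by rewrite exprVn.
apply: le_trans (_ : 1 <= _); first by rewrite exprn_ile1 //; lra.
by rewrite exprn_ege1 // ler1n.
Qed.

Lemma half_exp_le1 n : 2^-1 ^+ n <= 1 :> R.
Proof. by rewrite exprn_ile1 //; lra. Qed.

Lemma half_exp_gt0 n : 0 < 2^-1 ^+ n :> R.
Proof. by rewrite exprn_gt0 // invr_gt0. Qed.

(** In the chain, put [z = 2 ^ k]: as [2^-|k|] is at most 1 and at most [z], its product with
    [1 + z] is at most [2 * z]. *)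
Lemma spec_tip_ge i : mesh 2 / 2 * 2^-1 ^+ `|i.1.1|%N <= spec_tip i.
Proof.
have b0 := mesh2_gt0.
have h := half_exp_le1 `|i.1.1|%N; have h0 := half_exp_gt0 `|i.1.1|%N.
rewrite /spec_tip; case: eqVneq => [_|j0].
  case: (ch); last by nra.
  have hz := half_absz_le i.1.1; have z0 := pow2_gt0 i.1.1.
  rewrite /chain -mulrA ler_pM2l // ler_pdivlMr ?addr_gt0 //; nra.
have : mesh 2 <= mesh (i.1.2).*2 by rewrite mesh_le -[X in (X <= _)%N]/(1.*2) leq_double lt0n.
by nra.
Qed.

Lemma spec_scale_le i : spec_scale i <= mesh 2 / 4 * 2^-1 ^+ `|i.1.1|%N.
Proof.
rewrite /spec_scale exprD mulrA ler_piMr ?half_exp_le1 // mulr_ge0 ?ltW ?half_exp_gt0 //.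
by rewrite divr_gt0 ?mesh2_gt0.
Qed.

Lemma mesh_cut_gt0 : 0 < mesh l.*2.
Proof. by apply: mesh_gt0; rewrite double_gt0. Qed.

Lemma mesh_cut_lt1 : mesh l.*2 < 1.
Proof. by rewrite -mesh_max mesh_lt; lia. Qed.

Lemma spec_tip_gt0 i : 0 < spec_tip i.
Proof.
apply: lt_le_trans (spec_tip_ge i); rewrite mulr_gt0 ?half_exp_gt0 //.
by rewrite divr_gt0 ?mesh2_gt0.
Qed.

Lemma spec_tip_le i : spec_tip i <= mesh l.*2.
Proof.
rewrite /spec_tip; case: eqVneq => [_|_].
  case: (ch); last by rewrite mesh_le; lia.
  by apply: ltW; apply: lt_le_trans (chain_lt (pow2_gt0 _)) _; rewrite mesh_le; lia.
by rewrite mesh_le leq_double -ltnS.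
Qed.

Lemma spec_scale_gt0 i : 0 < spec_scale i.
Proof. by rewrite mulr_gt0 ?half_exp_gt0 // divr_gt0 ?mesh2_gt0. Qed.

Lemma spec_scale_half i : spec_scale i <= 2^-1.
Proof.
apply: le_trans (spec_scale_le i) _; have b0 := mesh2_gt0.
have := mesh2_le1; have := half_exp_le1 `|i.1.1|%N; have := half_exp_gt0 `|i.1.1|%N; nra.
Qed.

Lemma spec_scale_cut i : spec_scale i * mesh l.*2 < spec_tip i.
Proof.
have := spec_tip_ge i; have := spec_scale_le i; have := spec_scale_gt0 i.
have := half_exp_gt0 `|i.1.1|%N; have := mesh_cut_lt1.
set a := 2^-1 ^+ _; set c := mesh l.*2; set s := spec_scale i; set t := spec_tip i.
move=> c1 a0 s0 h1 h2; have ab : 0 < mesh 2 * a by rewrite mulr_gt0 ?mesh2_gt0.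
have sc : s * c < s by rewrite -[X in _ < X]mulr1 ltr_pM2l.
by lra.
Qed.

Lemma spec_scale_fin e : 0 < e -> exists L : seq alphabet, forall i, e <= spec_scale i -> i \in L.
Proof.
move=> e0; have [n hn] := half_expn_small e0; have b0 := mesh2_gt0.
pose ks := [seq Posz a | a <- iota 0 n] ++ [seq - Posz a | a <- iota 0 n].
exists [seq (x, m) | x <- [seq (k, j) | k <- ks, j <- enum 'I_l.+1], m <- iota 0 n].
move=> [[k j] m] he.
have hkm : (`|k|%N + m < n)%N.
  rewrite ltnNge; apply/negP => hle; have : spec_scale (k, j, m) < e; last by rewrite ltNge he.
  apply: le_lt_trans hn; rewrite /spec_scale /= -(subnK hle) exprD mulrA.
  apply: ler_piMl; first exact/ltW/half_exp_gt0.
  have := mesh2_le1; have := half_exp_le1 (`|k| + m - n); have := half_exp_gt0 (`|k| + m - n).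
  by nra.
apply: allpairs_f; last by rewrite mem_iota; lia.
apply: allpairs_f; last by rewrite mem_enum.
rewrite mem_cat; apply/orP; case: (leP 0 k) => k0; [left | right]; apply/mapP;
  exists `|k|%N; rewrite ?mem_iota; lia.
Qed.

Definition fan_spec_of : fan_spec R :=
  FanSpec mesh_cut_gt0 mesh_cut_lt1 spec_tip_gt0 spec_tip_le
    spec_scale_gt0 spec_scale_half spec_scale_cut spec_scale_fin.

End Spec.

(** * Tips, gaps, and the shift along the chain *)

Section Orbits.
Context {R : realType} (l : nat) (ch : bool) (l_gt0 : (0 < l)%N).
Implicit Types (k : int) (n m j : nat) (z r u v : R).
Let P : fan_spec R := fan_spec_of (R := R) ch l_gt0.
Notation mesh := (@mesh R l).
Notation chain := (@chain R l).

Let i0 : letter P := ((0 : int, ord0 : 'I_l.+1, 0%N) : alphabet l).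

Lemma spec_tip_rep (i : letter P) r : 0 < r -> exists2 j : letter P, tip j = tip i & scale j < r.
Proof.
move=> r0; have [n hn] := half_expn_small r0.
case: i => [[k j] m]; exists ((k, j, n) : alphabet l) => //; apply: le_lt_trans hn.
rewrite [scale _]/(spec_scale _) /spec_scale /= exprD mulrA.
apply: ler_piMl; first exact/ltW/half_exp_gt0.
have := @mesh2_gt0 R l; have := @mesh2_le1 R l.
by have := @half_exp_le1 R `|k|; have := @half_exp_gt0 R `|k|; nra.
Qed.

Lemma tipP (i : letter P) : (ch /\ exists k, tip i = chain (2 ^ k)) \/
  (exists2 j, (0 < j <= l)%N & tip i = mesh j.*2).
Proof.
case: i => [[k j] m]; rewrite [tip _]/(spec_tip _ _) /spec_tip /=.
case: eqVneq => [_|j0]; last first.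
  by right; exists j => //; rewrite lt0n j0 -ltnS ltn_ord.
case: (boolP ch) => hc; [left | right]; first by split=> //; exists k.
by exists 1%N.
Qed.

Lemma tip_height_mesh j : (0 < j <= l)%N -> tip_height P (mesh j.*2).
Proof.
move=> /andP[j0 jl]; have jl' : (j < l.+1)%N by [].
exists ((0 : int, Ordinal jl', 0%N) : alphabet l); rewrite [tip _]/(spec_tip _ _) /spec_tip /=.
by case: eqVneq => // /(congr1 val) /= h; rewrite h in j0.
Qed.

Lemma tip_height_chain k : ch -> tip_height P (chain (2 ^ k)).
Proof.
by move=> hc; exists ((k, ord0 : 'I_l.+1, 0%N) : alphabet l); rewrite [tip _]/(spec_tip _ _) /spec_tip /= hc.
Qed.

Lemma gap_mesh j : (0 < j <= l)%N || (j == 0%N) && ~~ ch ->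
  forall i : letter P, tip i <= mesh j.*2 \/ mesh j.*2.+2 <= tip i.
Proof.
move=> h i; have [[hc [k ->]]|[m /andP[m0 ml] ->]] := tipP i.
  left; apply: ltW; apply: lt_le_trans (chain_lt l (pow2_gt0 _)) _.
  by rewrite mesh_le; move: h; rewrite hc andbF orbF; lia.
by rewrite !mesh_le; have [mj|jm] := leqP m j; [left | right]; lia.
Qed.

Lemma gap_chain k (i : letter P) : tip i <= chain (2 ^ k) \/ chain (2 ^ (k + 1)) <= tip i.
Proof.
have [[hc [k' ->]]|[m /andP[m0 ml] ->]] := tipP i; last first.
  right; apply: ltW; apply: lt_le_trans (chain_lt l (pow2_gt0 _)) _.
  by rewrite mesh_le; lia.
have g : 1 < (2 : R) by rewrite ltr1n.
rewrite !leNgt !chain_mono ?pow2_gt0 // -!leNgt.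
have [kk|kk] := leP k' k; [left | right]; apply: ler_weXz2l; rewrite ?(ltW g) //.
by rewrite lezD1.
Qed.

Variant height_spec r : Prop :=
| HeightMesh j of (0 < j <= l)%N & r = mesh j.*2
| HeightGap j of (0 < j <= l)%N || (j == 0%N) && ~~ ch & mesh j.*2 < r < mesh j.*2.+2
| HeightChain k of ch & r = chain (2 ^ k)
| HeightChainGap k of ch & chain (2 ^ k) < r < chain (2 ^ (k + 1)).

Lemma heightP r : 0 < r -> r < 1 -> height_spec r.
Proof.
move=> r0 r1; pose N : R := (l.*2.+2)%:R.
have N0 : 0 < N by rewrite ltr0n.
have rN : 0 <= r * N / 2 by rewrite divr_ge0 // mulr_ge0 // ltW.
have /andP[h1 h2] := truncn_itv rN; set j := Num.trunc _ in h1 h2.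
have e1 : mesh j.*2 <= r.
  by rewrite /mesh ler_pdivrMr // -/N -(mul2n j) natrM; lra.
have e2 : r < mesh j.*2.+2.
  by rewrite /mesh ltr_pdivlMr // -/N -doubleS -(mul2n j.+1) natrM; lra.
have jl : (j <= l)%N.
  have := le_lt_trans e1 r1; rewrite -(@mesh_max R l) mesh_lt; lia.
have [j0|jn0] := posnP j; last first.
  move: e1; rewrite le_eqVlt => /orP[/eqP e|e1].
    by apply: (@HeightMesh _ j) => //; rewrite jn0.
  by apply: (@HeightGap _ j); rewrite ?jn0 ?jl // e1.
rewrite j0 /= in e2; case: (boolP ch) => hc; last first.
  by apply: (@HeightGap _ 0); rewrite ?hc //= mesh0 r0.
have [z z0 rz] := chain_surj r0 e2; have [k /andP[]] := floor_log2 z0.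
rewrite le_eqVlt => /orP[/eqP kz _|kz zk].
  by apply: (@HeightChain _ k) => //; rewrite kz.
by apply: (@HeightChainGap _ k) => //; rewrite -rz !chain_mono ?pow2_gt0 // kz.
Qed.

Lemma spec_tip_or_gap r : 0 < r -> r < 1 -> tip_height P r \/
  exists u v, [/\ 0 <= u, u < r, r < v, v <= 1 &
    forall i : letter P, tip i <= u \/ v <= tip i].
Proof.
move=> r0 r1; case: (heightP r0 r1) => [j jl ->|j jl /andP[jr rj]|k hc ->|k hc /andP[kr rk]].
- by left; exact: tip_height_mesh.
- right; exists (mesh j.*2), (mesh j.*2.+2); split=> //.
  + by rewrite -(@mesh0 R l) mesh_le.
  + by rewrite -(@mesh_max R l) mesh_le; move: jl; lia.
  + exact: gap_mesh.
- by left; exact: tip_height_chain.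
- right; exists (chain (2 ^ k)), (chain (2 ^ (k + 1))); split=> //.
  + exact/ltW/chain_gt0/pow2_gt0.
  + by apply: ltW; apply: lt_le_trans (chain_lt l (pow2_gt0 _)) _; exact: mesh2_le1.
  + exact: gap_chain.
Qed.

(* Conjugate to doubling by [chain]. *)
Definition shift r : R :=
  let m := Num.min (Num.max r 0) (mesh 2) in
  2 * m / (1 + m / mesh 2) + Num.max (r - mesh 2) 0.

Let b0 : 0 < mesh 2 := @mesh2_gt0 R l.

Lemma shift_continuous : continuous shift.
Proof.
have c1 : continuous (fun r => Num.max r 0).
  by apply: max_continuous => x; [exact: cvg_id | exact: cvg_cst].
have c2 : continuous (fun r => Num.min (Num.max r 0) (mesh 2)).
  by apply: min_continuous => // x; exact: cvg_cst.
have c3 : continuous (fun r => Num.max (r - mesh 2) 0).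
  apply: max_continuous => x; last exact: cvg_cst.
  by apply: cvgB; [exact: cvg_id | exact: cvg_cst].
move=> x; apply: cvgD; last exact: c3.
apply: cvgM; first by apply: cvgMl_tmp; exact: c2.
apply: cvgV.
  rewrite gt_eqF // ltr_wpDr // divr_ge0 ?(ltW b0) //.
  by rewrite le_min le_max lexx orbT ltW.
by apply: cvgD; [exact: cvg_cst | apply: cvgMr_tmp; exact: c2].
Qed.

Lemma shift_high r : mesh 2 <= r -> shift r = r.
Proof.
move=> h; have r0 : 0 <= r by rewrite (le_trans (ltW b0)).
rewrite /shift (max_idPl r0) (min_idPr h) (max_idPl _) ?subr_ge0 // divff ?gt_eqF //.
by field.
Qed.

Lemma shift_low r : 0 <= r <= mesh 2 -> shift r = 2 * r / (1 + r / mesh 2).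
Proof.
move=> /andP[r0 h].
by rewrite /shift (max_idPl r0) (min_idPl h) (max_idPr _) ?subr_le0 // addr0.
Qed.

Lemma shift_chain z : 0 < z -> shift (chain z) = chain (2 * z).
Proof.
move=> z0; rewrite shift_low ?(ltW (chain_gt0 l z0)) ?(ltW (chain_lt l z0)) //.
by rewrite /chain; field; rewrite !gt_eqF //; lra.
Qed.

Lemma shift_mono u v : 0 <= u -> u < v -> shift u < shift v.
Proof.
have lo x y : 0 <= x -> x < y -> y <= mesh 2 -> shift x < shift y.
  move=> x0 xy yb; have y0 : 0 < y by exact: le_lt_trans xy.
  rewrite !shift_low ?x0 ?(ltW y0) ?yb ?(le_trans (ltW xy)) //.
  have q0 t : 0 <= t -> 0 < 1 + t / mesh 2 by move=> t0; rewrite ltr_wpDr // divr_ge0 // ltW.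
  rewrite ltr_pdivrMr ?q0 // mulrAC ltr_pdivlMr ?q0 ?(ltW y0) //.
  by move: (mesh 2)^-1 => c; lra.
move=> u0 uv; have [vb|bv] := leP v (mesh 2); first exact: lo.
have [bu|ub] := leP (mesh 2) u; first by rewrite !shift_high // (le_trans bu (ltW uv)).
by apply: lt_trans (lo _ _ u0 ub (lexx _)) _; rewrite !shift_high ?(ltW bv).
Qed.

(** Raising [k] by one moves each chain point to the next and fixes the other tips. As [|k|] drops
    by at most one, scales grow by at most the factor 2. *)
Lemma same_orbit_shift r : 0 <= r <= 1 -> same_orbit (pt (P := P) [::] r) (pt [::] (shift r)).
Proof.
pose g (i : letter P) : letter P := (((i : alphabet l).1.1 + 1, (i : alphabet l).1.2, (i : alphabet l).2) : alphabet l).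
pose g' (i : letter P) : letter P := (((i : alphabet l).1.1 - 1, (i : alphabet l).1.2, (i : alphabet l).2) : alphabet l).
apply: (@root_leg_homeo _ P g g' shift 2) => //; last by rewrite ler1n.
- by move=> [[k j] m]; rewrite /g /g' /= addrK.
- by move=> [[k j] m]; rewrite /g /g' /= subrK.
- move=> [[k j] m]; rewrite [scale _]/(spec_scale _) [X in _ <= _ * X]/(spec_scale _) /spec_scale /=.
  rewrite mulrCA ler_pM2l ?divr_gt0 //.
  have [d hd] : exists d, ((absz (k + 1)%R + m).+1 = absz k + m + d)%N.
    by exists ((absz (k + 1)%R + m).+1 - (absz k + m))%N; lia.
  have -> : 2^-1 ^+ (absz (k + 1)%R + m) = 2 * 2^-1 ^+ (absz k + m + d) :> R.
    by rewrite -hd exprS mulrA divff ?mul1r // pnatr_eq0.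
  rewrite ler_pM2l ?ltr0n // exprD; apply: ler_piMr; last exact: half_exp_le1.
  exact/ltW/half_exp_gt0.
- exact: shift_continuous.
- by move=> x y x0 xy _; exact: shift_mono.
- by rewrite shift_low ?lexx ?(ltW b0) // mulr0 mul0r.
- by rewrite shift_high // mesh2_le1.
- move=> [[k j] m]; rewrite [tip _]/(spec_tip _ _) [RHS]/(spec_tip _ _) /spec_tip /=.
  case: eqVneq => [_|j0]; last first.
    by rewrite shift_high // mesh_le -[X in (X <= _)%N]/(1.*2) leq_double lt0n.
  case: (ch); last by rewrite shift_high.
  rewrite shift_chain ?pow2_gt0 // expfzDr ?pnatr_eq0 // mulrC.
  by congr (chain (_ * _)).
Qed.

Lemma same_orbit_chain z n : 0 < z ->
  same_orbit (pt (P := P) [::] (chain z)) (pt [::] (chain (2 ^+ n * z))).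
Proof.
move=> z0; elim: n => [|n IH]; first by rewrite expr0 mul1r; exact: same_orbit_refl.
have zn : 0 < 2 ^+ n * z by rewrite mulr_gt0 // exprn_gt0.
apply: same_orbit_trans IH _; rewrite exprS -mulrA -shift_chain //.
apply: same_orbit_shift; rewrite ltW ?chain_gt0 //=.
exact: le_trans (ltW (chain_lt l zn)) (@mesh2_le1 R l).
Qed.

Lemma same_orbit_chain_int z k : 0 < z ->
  same_orbit (pt (P := P) [::] (chain (2 ^ k * z))) (pt [::] (chain z)).
Proof.
move=> z0; case: k => n; first exact/same_orbit_sym/same_orbit_chain.
have h := same_orbit_chain n.+1 (mulr_gt0 (@pow2_gt0 R (Negz n)) z0).
by move: h; rewrite NegzE -exprnN mulrA divff ?mul1r // expf_neq0 // pnatr_eq0.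
Qed.

End Orbits.

(** * Representatives of the orbits and their separation *)

Section Count.
Context {R : realType} (l : nat) (ch : bool) (l_gt0 : (0 < l)%N).
Implicit Types (k : int) (n m j : nat) (z r u v : R).
Let P : fan_spec R := fan_spec_of (R := R) ch l_gt0.
Notation mesh := (@mesh R l).
Notation chain := (@chain R l).
Notation N := (l.*2.+2).

Let i0 : letter P := ((0 : int, ord0 : 'I_l.+1, 0%N) : alphabet l).

(** With a chain, the index 1 stands for its points, because [mesh 1 = chain 1], and the additional
    index [N + 1] for the gaps between them: [3 / 2] lies between [2 ^ 0] and [2 ^ 1]. *)
Definition rep_height n : R := if (n <= N)%N then mesh n else chain (3 / 2).

Lemma chain1 : chain 1 = mesh 1.
Proof.
have : (N%:R : R) != 0 by rewrite pnatr_eq0.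
by rewrite /chain /mesh; move: (N%:R) => a a0; field; rewrite a0.
Qed.

Lemma rep_height_chain_gt : chain (2 ^ 0) < chain (3 / 2) /\ chain (3 / 2) < chain (2 ^ (0 + 1)).
Proof. by rewrite add0r expr0z expr1z !chain_mono //; lra. Qed.

Lemma reach_rep r : 0 < r -> r <= 1 -> exists2 n, (0 < n <= N + ch)%N &
  same_orbit (pt (P := P) [::] r) (pt [::] (rep_height n)).
Proof.
move=> r0; rewrite le_eqVlt => /orP[/eqP -> |r1].
  exists N; first by lia.
  by rewrite /rep_height leqnn mesh_max; exact: same_orbit_refl.
case: (heightP ch l_gt0 r0 r1) => [j jl ->|j jl /andP[jr rj]|k hc ->|k hc /andP[kr rk]].
- exists j.*2; first by lia.
  by rewrite /rep_height ifT; [exact: same_orbit_refl | lia].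
- have jl' : (j <= l)%N by move: jl; lia.
  exists j.*2.+1; first by lia.
  rewrite /rep_height ifT; last by lia.
  apply: (same_orbit_gap (u := mesh j.*2) (v := mesh j.*2.+2)) => //.
  + by rewrite -(@mesh0 R l) mesh_le.
  + by rewrite -(@mesh_max R l) mesh_le; lia.
  + by rewrite mesh_lt.
  + by rewrite mesh_lt.
  + exact: gap_mesh.
- exists 1%N; first by rewrite hc.
  rewrite /rep_height /= -chain1 -[2 ^ k]mulr1.
  exact: same_orbit_chain_int.
exists N.+1; first by rewrite hc; lia.
rewrite /rep_height ltnn.
have rl : r < mesh 2 by apply: lt_le_trans rk _; exact/ltW/chain_lt/pow2_gt0.
have [z z0 rz] := chain_surj r0 rl; rewrite -rz in kr rk *.
move: kr rk; rewrite !chain_mono ?pow2_gt0 // expfzDr ?pnatr_eq0 // expr1z => kz zk.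
have p0 := @pow2_gt0 R k.
(* A power of the shift brings [z] between 1 and 2, into the gap that contains [3 / 2]. *)
have zE : z = 2 ^ k * (z / 2 ^ k) by rewrite mulrCA divff ?mulr1 // gt_eqF.
have z1 : 1 < z / 2 ^ k by rewrite ltr_pdivlMr // mul1r.
have z2 : z / 2 ^ k < 2 by rewrite ltr_pdivrMr // mulrC.
have z'0 : 0 < z / 2 ^ k by rewrite divr_gt0.
rewrite zE; apply: same_orbit_trans (same_orbit_chain_int ch l_gt0 k z'0) _.
have [g1 g2] := rep_height_chain_gt.
apply: (same_orbit_gap (u := chain (2 ^ 0)) (v := chain (2 ^ (0 + 1)))) => //.
- exact/ltW/chain_gt0/pow2_gt0.
- exact: le_trans (ltW (chain_lt l (pow2_gt0 _))) (@mesh2_le1 R l).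
- by rewrite expr0z chain_mono.
- by rewrite add0r expr1z chain_mono.
- exact: gap_chain.
Qed.

Definition inner n := (0 < n <= N + ch)%N && (n != N).

Lemma rep_height_inner n : inner n -> 0 < rep_height n /\ rep_height n < 1.
Proof.
move=> /andP[/andP[n0 nN] ne]; rewrite /rep_height; case: leqP => nN'.
  by rewrite mesh_gt0 // -(@mesh_max R l) mesh_lt; split=> //; lia.
have h : 0 < 3 / 2 :> R by lra.
split; first exact: chain_gt0.
exact: lt_le_trans (chain_lt l h) (@mesh2_le1 R l).
Qed.

Definition at_tip n := (n <= N)%N && ~~ odd n || ch && (n == 1%N).

Lemma mesh_inj : injective mesh.
Proof. by move=> n m e; apply/eqP; rewrite eqn_leq -!(@mesh_le R l) e lexx. Qed.

Lemma pow2_neq k : (2 : R) ^ k != 3 / 2.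
Proof.
have g : 1 <= (2 : R) by rewrite ler1n.
have [k0|k0] := leP k 0.
  by have := ler_weXz2l g k0; rewrite expr0z => h; rewrite lt_eqF //; apply: le_lt_trans h _; lra.
have k1 : (1 <= k)%R by [].
by have := ler_weXz2l g k1; rewrite expr1z => h; rewrite gt_eqF //; apply: lt_le_trans h; lra.
Qed.

Lemma tip_height_rep n : inner n -> tip_height P (rep_height n) <-> at_tip n.
Proof.
move=> /andP[/andP[n0 nN] ne]; rewrite /at_tip /rep_height; case: leqP => /= nN'; last first.
  have hc : ch by move: nN; case: (ch) => //; lia.
  rewrite hc (_ : (n == 1%N) = false); last by lia.
  split=> // -[i]; have h : 0 < 3 / 2 :> R by lra.
  have [[_ [k ->]] e|[j /andP[j0 jl] -> e]] := tipP i.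
    have /eqP := pow2_neq k; case; have p0 := @pow2_gt0 R k.
    have := chain_mono l p0 h; have := chain_mono l h p0; rewrite e ltxx.
    by case: ltgtP.
  have := chain_lt l h; rewrite -e mesh_lt; lia.
split=> [[i]|].
  have [[hc [k ->]] e|[j /andP[j0 jl] -> /mesh_inj <-]] := tipP i.
    have := chain_lt l (@pow2_gt0 R k); rewrite e mesh_lt hc => h.
    by apply/orP; right; lia.
  by rewrite odd_double.
move=> /orP[on|/andP[hc /eqP ->]]; last first.
  by rewrite -chain1 -(expr0z 2); exact: tip_height_chain.
rewrite -(even_halfK on); apply: tip_height_mesh.
by move: n0 nN' ne; rewrite -{1 2 3}(even_halfK on); lia.
Qed.

(** The representatives inside the chain, the only inner ones with infinitely many tip heights above
    them. *)
Definition below_chain n := ch && ((n == 1%N) || (n == N.+1)).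

Definition mesh_tips n : seq R :=
  [seq mesh j.*2 | j <- iota (uphalf n) (l.+1 - uphalf n)].

Lemma mesh_tips_uniq n : uniq (mesh_tips n).
Proof.
rewrite map_inj_uniq ?iota_uniq // => i j /mesh_inj; lia.
Qed.

Lemma mesh_tipsP n s : (0 < n)%N -> s \in mesh_tips n ->
  exists j, [/\ (0 < j <= l)%N, (n <= j.*2)%N & s = mesh j.*2].
Proof.
move=> n0 /mapP[j]; rewrite mem_iota => h ->; exists j.
by split=> //; move: h; rewrite uphalf_half; have := odd_double_half n; lia.
Qed.

(** For a height in the chain a finite list is enough: [chain 2] and the [l] mesh tips are [l + 1]
    in number, more than lie above any inner height outside the chain. *)
Definition rep_tips n : seq R :=
  if below_chain n then chain (2 ^ 1) :: mesh_tips 1 else mesh_tips n.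

Lemma rep_tips_uniq n : uniq (rep_tips n).
Proof.
rewrite /rep_tips; case: ifP => _; last exact: mesh_tips_uniq.
rewrite cons_uniq mesh_tips_uniq andbT; apply/negP => /mesh_tipsP[//|j [h _ e]].
by have := chain_lt l (@pow2_gt0 R 1); rewrite e mesh_lt; lia.
Qed.

Lemma rep_tips_sub n s : inner n -> s \in rep_tips n -> tip_height P s /\ rep_height n <= s.
Proof.
move=> /andP[/andP[n0 nN] ne]; rewrite /rep_tips; case: ifP => [/andP[hc h]|h].
  have e1 : rep_height n <= chain (2 ^ 1).
    rewrite /rep_height; case: leqP => nN'.
      have -> : n = 1%N by move: h; lia.
      by rewrite -chain1 ltW // chain_mono // expr1z ltr1n.
    by rewrite ltW // chain_mono ?expr1z //; lra.
  rewrite inE => /orP[/eqP ->|/mesh_tipsP[//|j [jl _ ->]]].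
    by split=> //; exact: tip_height_chain.
  split; first exact: tip_height_mesh.
  apply: le_trans e1 _; apply: ltW; apply: lt_le_trans (chain_lt l (pow2_gt0 _)) _.
  by rewrite mesh_le; lia.
move=> /mesh_tipsP[//|j [jl nj ->]]; split; first exact: tip_height_mesh.
rewrite /rep_height; case: leqP => nN'; first by rewrite mesh_le.
by move: h; rewrite /below_chain; move: nN; case: (ch) => /=; lia.
Qed.

Lemma rep_tips_all n s : inner n -> ~~ below_chain n -> tip_height P s ->
  rep_height n <= s -> s \in mesh_tips n.
Proof.
move=> /andP[/andP[n0 nN] ne] fn [i <-]; have nN' : (n <= N)%N.
  by move: fn nN; rewrite /below_chain; case: (ch) => /=; lia.
rewrite /rep_height nN'; have [[hc [k ->]]|[j jl ->]] := tipP i.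
  move=> /le_lt_trans/(_ (chain_lt l (pow2_gt0 _))); rewrite mesh_lt.
  by move: fn; rewrite /below_chain hc; lia.
rewrite mesh_le => nj; apply/mapP; exists j => //; rewrite mem_iota.
by move: nj; rewrite uphalf_half; have := odd_double_half n; lia.
Qed.

Lemma inner_le n : inner n -> ~~ below_chain n -> (n <= N)%N.
Proof.
by move=> /andP[/andP[_ +] _]; rewrite /below_chain; case: (ch) => /=; lia.
Qed.

Lemma at_tip_even n : inner n -> ~~ below_chain n -> at_tip n = ~~ odd n.
Proof.
move=> hn fn; rewrite /at_tip inner_le //=; case: (boolP (ch && (n == 1%N))); rewrite ?orbF //.
by move=> /andP[hc h1]; move: fn; rewrite /below_chain hc h1.
Qed.

Lemma at_tip_below_chain n m : below_chain n -> below_chain m -> at_tip n = at_tip m -> n = m.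
Proof.
have h0 : (N.+1 <= N)%N = false by rewrite ltnn.
have h1 : (N.+1 == 1%N) = false by [].
move=> /andP[hc /orP[]/eqP ->] /andP[_ /orP[]/eqP ->] //; rewrite /at_tip hc h0 h1 /=;
  by rewrite ?orbT ?orbF.
Qed.

Lemma size_rep_tips n :
  size (rep_tips n) = if below_chain n then l.+1 else (l.+1 - uphalf n)%N.
Proof. by rewrite /rep_tips; case: ifP => _; rewrite /= size_map size_iota ?subn1. Qed.

Lemma uphalf_odd_inj n m : uphalf n = uphalf m -> odd n = odd m -> n = m.
Proof.
by have := odd_double_half n; have := odd_double_half m; rewrite !uphalf_half; lia.
Qed.

(** The number of tip heights at or above the representative determines [uphalf n], and being a tip
    height gives the parity. Inside the chain the second invariant is enough. *)
Lemma rep_height_inj n m : inner n -> inner m ->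
  same_orbit (pt (P := P) [::] (rep_height n)) (pt [::] (rep_height m)) -> n = m.
Proof.
move=> hn hm o; have [n0 n1] := rep_height_inner hn; have [m0 m1] := rep_height_inner hm.
have rep := @spec_tip_rep R l ch l_gt0; have gap := @spec_tip_or_gap R l ch l_gt0.
have o' := same_orbit_sym o.
have st : at_tip n = at_tip m.
  apply/idP/idP => /tip_height_rep h; apply/tip_height_rep => //.
    exact: same_orbit_tip_height o (h hn).
  exact: same_orbit_tip_height o' (h hm).
have count a b : inner a -> inner b -> ~~ below_chain b ->
    same_orbit (pt (P := P) [::] (rep_height a)) (pt [::] (rep_height b)) ->
    (size (rep_tips a) <= l.+1 - uphalf b)%N.
  move=> ha hb fb oab; have [a0 a1] := rep_height_inner ha; have [b0 b1] := rep_height_inner hb.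
  have := same_orbit_count rep gap i0 a0 (ltW a1) b0 b1 oab (rep_tips_uniq a)
    (fun s => @rep_tips_sub a s ha) (fun s => @rep_tips_all b s hb fb).
  by rewrite size_map size_iota.
have uph a : inner a -> (0 < uphalf a)%N by move=> /andP[/andP[+ _] _]; case: a.
have := count _ _ hn hm; have := count _ _ hm hn; rewrite !size_rep_tips.
have [fn|fn] := boolP (below_chain n); have [fm|fm] := boolP (below_chain m).
- by move=> _ _; exact: at_tip_below_chain.
- by move=> _ /(_ isT o); rewrite leqNgt ltn_subrL uph.
- by move=> /(_ isT o'); rewrite leqNgt ltn_subrL uph.
have uphN a : inner a -> ~~ below_chain a -> (uphalf a <= l.+1)%N.
  by move=> ha fa; rewrite leq_uphalf_double doubleS inner_le.
move=> /(_ isT o') h1 /(_ isT o) h2; apply: uphalf_odd_inj.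
  apply/eqP; rewrite eqn_leq -(leq_sub2lE _ (uphN _ hn fn)) h1.
  by rewrite -(leq_sub2lE _ (uphN _ hm fm)) h2.
by move: st; rewrite !at_tip_even // => /negb_inj.
Qed.

Lemma fan_fractionally_homogeneous : fractionally_homogeneous (fan P) (N.+1 + ch).
Proof.
pose rep (i : 'I_(N.+1 + ch)) : fan P := pt [::] (rep_height i).
apply: (fractionally_homogeneous_reps (rep := rep)).
  have hT n (nN : (n <= N + ch)%N) : exists i, rep i = pt [::] (rep_height n).
    by have nN' : (n < N.+1 + ch)%N; [lia | exists (Ordinal nN')].
  move=> x; have [->|/height_gt0 x0] := pselect (x = top).
    have [i hi] := hT 0%N isT; exists i; rewrite hi /rep_height /= mesh0 pt_le0 //.
    exact: same_orbit_refl.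
  have xa : 0 < height x <= len (arm x) by rewrite x0 height_le.
  have [r [/andP[r0 r1] _] o1] := same_orbit_root xa; rewrite ptK in o1.
  have [n /andP[n0 nN] o2] := reach_rep r0 r1; have [i hi] := hT n nN.
  by exists i; rewrite hi; exact: same_orbit_trans o2.
have pos n : (0 < n)%N -> 0 < rep_height n.
  move=> n0; rewrite /rep_height; case: ifP => _; first exact: mesh_gt0.
  by apply: chain_gt0; lra.
have rep0 : rep_height 0 = 0 by rewrite /rep_height /= mesh0.
have repN : rep_height N = 1 by rewrite /rep_height leqnn mesh_max.
suff key n m : (n <= N + ch)%N -> (m <= N + ch)%N ->
    same_orbit (pt (P := P) [::] (rep_height n)) (pt [::] (rep_height m)) -> n = m.
  by move=> i j o; apply: val_inj; apply: key o; rewrite -ltnS -addSn; exact: ltn_ord.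
move=> nN mN o.
have [n0|n0] := posnP n; have [m0|m0] := posnP m.
- by rewrite n0 m0.
- by move: o; rewrite n0 rep0 pt_le0 // => /(top_neq_pt i0 (pos _ m0)).
- by move: o => /same_orbit_sym; rewrite m0 rep0 pt_le0 // => /(top_neq_pt i0 (pos _ n0)).
have [nE|nE] := eqVneq n N; have [mE|mE] := eqVneq m N.
- by rewrite nE mE.
- have [|a b] := @rep_height_inner m; first by rewrite /inner m0 mN mE.
  by move: o => /same_orbit_sym; rewrite nE repN => /(tip_neq_pt i0 a b).
- have [|a b] := @rep_height_inner n; first by rewrite /inner n0 nN nE.
  by move: o; rewrite mE repN => /(tip_neq_pt i0 a b).
by apply: rep_height_inj o; rewrite /inner ?n0 ?nN ?m0 ?mN.
Qed.

Lemma spec_fan_properties : [/\ smooth_fan (fan P), endpoint_homogeneous (fan P) &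
  fractionally_homogeneous (fan P) (N.+1 + ch)].
Proof.
split; [exact: fan_smooth i0 | exact: fan_endpoint_homogeneous i0 |].
exact: fan_fractionally_homogeneous.
Qed.

End Count.

Theorem theorem6p2 (R : realType) (n : nat) (hn : (5 <= n)%N) :
  exists F : metricType R,
    [/\ smooth_fan F, endpoint_homogeneous F & fractionally_homogeneous F n].
Proof.
(* With [l = (n - 3)./2], an odd [n] is [2 l + 3] and needs no chain, while an even [n] is [2 l + 4]
   and does. *)
have l0 : (0 < (n - 3)./2)%N by rewrite half_gt0; lia.
have -> : n = (((n - 3)./2).*2.+3 + ~~ odd n)%N.
  by have := odd_double_half (n - 3); rewrite oddB; lia.
exists (fan (fan_spec_of (R := R) (~~ odd n) l0)); exact: spec_fan_properties.
Qed.
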